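(* Let $\mathbb{X}$ be an ACM set of points in $\mathbb{P}^1\times\mathbb{P}^1$, and suppose that \[0\rightarrow\mathbb{F}_2=\bigoplus_{(i,j)\in S_2}R(-i,-j)\rightarrow\mathbb{F}_1\rightarrow R\rightarrow R/I_{\mathbb{X}}\rightarrow0\] is the minimal $\mathbb{N}^2$-graded free resolution of $R/I_{\mathbb{X}}$. Let $P\in\mathbb{X}$ be any point. Then $\mathbb{Y}=\mathbb{X}\setminus\{P\}$ is ACM if and only if $\deg_{\mathbb{X}}(P)+(1,1)\in S_2$.
   Context: Let $k$ be an algebraically closed field of characteristic zero, $\mathbb{N}=\{0,1,2,\ldots\}$, and let $R=k[x_0,x_1,y_0,y_1]$ be $\mathbb{N}^2$-graded by $\deg x_0=\deg x_1=(1,0)$, $\deg y_0=\deg y_1=(0,1)$. For a finite set of points $\mathbb{X}$ in $\mathbb{P}^1\times\mathbb{P}^1$ (over $k$), $I_{\mathbb{X}}\subseteq R$ is the bihomogeneous ideal generated by the bihomogeneous forms vanishing at all points of $\mathbb{X}$ (so $I_\emptyset=R$). For nonempty $\mathbb{X}$ one has $\dim R/I_{\mathbb{X}}=2$; $\mathbb{X}$ is arithmetically Cohen–Macaulay (ACM) if $\operatorname{depth}R/I_{\mathbb{X}}=2$. The empty set is regarded as ACM. Order $\mathbb{N}^2$ by $(i_1,i_2)\succeq(j_1,j_2)$ iff $i_1\ge j_1$ and $i_2\ge j_2$. For $P\in\mathbb{X}$, a bihomogeneous form $F\in R$ is a separator for $P$ if $F(P)\neq0$ and $F(Q)=0$ for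 all $Q\in\mathbb{X}\setminus\{P\}$. The degree of $P\in\mathbb{X}$ is the set $\deg_{\mathbb{X}}(P)$ of minimal elements of $\{\deg F : F\text{ is a separator for }P\in\mathbb{X}\}\subseteq\mathbb{N}^2$. It is known that if $\mathbb{X}$ is ACM then $|\deg_{\mathbb{X}}(P)|=1$ for every $P\in\mathbb{X}$; in that case $\deg_{\mathbb{X}}(P)$ also denotes its unique element. $S_2$ is the multiset of bidegree shifts of $\mathbb{F}_2$. *)

(* Defs.v *)
From HB Require Import structures.
From mathcomp Require Import all_boot all_order all_algebra.
From mathcomp Require Import finmap.
From mathcomp Require Import mpoly.

Set Implicit Arguments.
Unset Strict Implicit.
Unset Printing Implicit Defensive.

Import GRing.Theory.
Local Open Scope ring_scope.

(* The variables x_i and y_i are 'X_(lshift 2 i) and 'X_(rshift 2 i). *)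
Notation biring k := {mpoly k[2 + 2]}.

(* The projective line as the set of lines through the origin of k^2. *)
Definition P1 (k : fieldType) : Type :=
  {U : {vspace 'rV[k]_2} | \dim U == 1%N}.
HB.instance Definition _ (k : fieldType) := Choice.on (P1 k).

Notation P1P1 k := (P1 k * P1 k)%type.

Section Points.
Variable k : fieldType.
Implicit Types (F : biring k) (P Q : P1P1 k) (X : {fset P1P1 k}).
Implicit Types d e : nat * nat.

Definition bideg (m : 'X_{1..2 + 2}) : nat * nat :=
  (\sum_(i < 2) m (lshift 2 i), \sum_(i < 2) m (rshift 2 i))%N.

(* As usual the zero form is bihomogeneous of every bidegree. *)
Definition bihomog d F : bool := all (fun m => bideg m == d) (msupp F).

Definition eval_vec (u v : 'rV[k]_2) F : k := F.@[row_mx u v 0].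

Lemma bihomog_eval_scale d F (a b : k) (u v : 'rV[k]_2) :
  bihomog d F ->
  eval_vec (a *: u) (b *: v) F = a ^+ d.1 * b ^+ d.2 * eval_vec u v F.
Proof.
move=> /allP hF; rewrite /eval_vec !mevalE big_distrr /=.
rewrite big_seq [RHS]big_seq; apply: eq_bigr => m /hF /eqP <-.
rewrite [RHS]mulrCA !big_split_ord /= -!prodrXr mulrACA.
by congr (_ * (_ * _)); rewrite -big_split; apply: eq_bigr => i _;
   rewrite /= ?row_mxEl ?row_mxEr mxE exprMn.
Qed.

(* F(P), computed on chosen homogeneous coordinates of P. *)
Definition eval_at P F : k := eval_vec (vpick (val P.1)) (vpick (val P.2)) F.

(* For bihomogeneous F, whether F(P) vanishes does not depend on the chosen
   coordinates. *)
Lemma eval_at_eq0 d F P (u v : 'rV[k]_2) : bihomog d F ->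
  u != 0 -> u \in val P.1 -> v != 0 -> v \in val P.2 ->
  (eval_at P F == 0) = (eval_vec u v F == 0).
Proof.
have scal (U : P1 k) (w : 'rV[k]_2) : w != 0 -> w \in val U ->
    exists2 c, c != 0 & w = c *: vpick (val U).
  move=> w0 wU; have vU := memv_pick (val U).
  have v0 : vpick (val U) != 0.
    by rewrite vpick0 -dimv_eq0; case: U {wU vU} => /= U /eqP ->.
  have eU : val U = <[vpick (val U)]>%VS.
    apply/esym/eqP; rewrite eqEdim dim_vline v0 -memvE vU /=.
    by case: U {wU vU v0} => /= U /eqP ->.
  move: wU; rewrite {1}eU => /vlineP [c wE]; exists c => //.
  by apply: contraNneq w0 => c0; rewrite wE c0 scale0r.
move=> hF u0 uP v0 vP.
have [a a0 ->] := scal _ _ u0 uP; have [b b0 ->] := scal _ _ v0 vP.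
rewrite (bihomog_eval_scale _ _ _ _ hF) mulf_eq0.
by rewrite mulf_eq0 !expf_eq0 (negbTE a0) (negbTE b0) !andbF.
Qed.

Definition ideal_gen (S : biring k -> Prop) F : Prop :=
  exists n (a g : 'I_n -> biring k),
    (forall i, S (g i)) /\ F = \sum_(i < n) a i * g i.

Definition ideal_of X : biring k -> Prop :=
  ideal_gen (fun F => (exists d, bihomog d F) /\
                      (forall P, P \in X -> eval_at P F = 0)).

Definition irrelevant : biring k -> Prop :=
  ideal_gen (fun F => exists i, F = 'X_i).

Definition ideal_plus (I : biring k -> Prop) (s : seq (biring k)) :
    biring k -> Prop :=
  ideal_gen (fun F => I F \/ F \in s).

(* s is a regular sequence on R/I contained in the irrelevant ideal. *)
Definition regular_seq (I : biring k -> Prop) (s : seq (biring k)) : Prop :=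
  [/\ forall F, F \in s -> irrelevant F,
      forall i F, (i < size s)%N ->
        ideal_plus I (take i s) (s`_i * F) -> ideal_plus I (take i s) F
    & ~ ideal_plus I s 1].

(* depth R/I = n, with respect to the irrelevant ideal. *)
Definition depth_quot (I : biring k -> Prop) (n : nat) : Prop :=
  (exists s, regular_seq I s /\ size s = n) /\
  (forall s, regular_seq I s -> (size s <= n)%N).

Definition ACM X : Prop := X = fset0 \/ depth_quot (ideal_of X) 2.

Definition separator X P F : Prop :=
  [/\ exists d, bihomog d F, eval_at P F != 0
    & forall Q, Q \in (X `\ P)%fset -> eval_at Q F = 0].

Definition separator_deg X P d : Prop :=
  exists2 F, separator X P F & bihomog d F.

Definition bideg_le d e : bool := (d.1 <= e.1)%N && (d.2 <= e.2)%N.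

(* d is an element of deg_X(P). *)
Definition in_deg X P d : Prop :=
  separator_deg X P d /\
  forall e, separator_deg X P e -> bideg_le e d -> e = d.

(* v is homogeneous of degree d in the sum over j < n of the R(-S_j). *)
Definition free_homog n (S : n.-tuple (nat * nat)) d (v : 'rV[biring k]_n) :
    Prop :=
  forall j, v 0 j = 0 \/
    exists e, d = tnth S j + e /\ bihomog e (v 0 j).

(* 0 -> F2 -d2-> F1 -d1-> R -> R/I -> 0 is a minimal N^2-graded free
   resolution, where F1, F2 have the multisets of shifts S1, S2. *)
Record minimal_resolution (I : biring k -> Prop) (n1 n2 : nat)
    (S1 : n1.-tuple (nat * nat)) (S2 : n2.-tuple (nat * nat))
    (d1 : {linear 'rV[biring k]_n1 -> (biring k)^o})
    (d2 : {linear 'rV[biring k]_n2 -> 'rV[biring k]_n1}) : Prop :=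
  MinimalResolution {
    res_graded1 : forall d v, free_homog S1 d v -> bihomog d (d1 v);
    res_graded2 : forall d w, free_homog S2 d w -> free_homog S1 d (d2 w);
    res_exact0 : forall F, I F <-> exists v, d1 v = F;
    res_exact1 : forall v, d1 v = 0 <-> exists w, d2 w = v;
    res_exact2 : injective d2;
    res_minimal1 : forall v, irrelevant (d1 v);
    res_minimal2 : forall w j, irrelevant (d2 w 0 j)
  }.

End Points.

(* Main.v *)
Require Import Defs.
From HB Require Import structures.
From Stdlib Require Import Classical.
From mathcomp Require Import all_boot all_order all_algebra.
From mathcomp Require Import finmap.
From mathcomp Require Import mpoly.
From mathcomp Require Import ring zify.

Set Implicit Arguments.
Unset Strict Implicit.
Unset Printing Implicit Defensive.

Import GRing.Theory.
Local Open Scope ring_scope.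

(** Write [I] for the ideal of [X], [l] and [m] for linear forms in the x's and
    in the y's that vanish at no point of [X], [F] for a separator of [P] of degree
    [d], and [Y] for [X] without [P]. Both sides of the equivalence turn out to
    say that [F] is not in [I + (l, m)].

    A nonempty set of points is ACM if and only if [m] is a nonzerodivisor
    modulo [I + (l)] ([ACM_nzd], [nzd_ACM]). Indeed [l] never vanishes on a
    component of the cone over [X], and modulo [I], [l] and [m] every variable
    is nilpotent, so that all questions about depth reduce to questions about
    socles. These are transported between regular sequences by hand: for
    length one in [nzd_exchange], and for length two in [depth_at_most_2], where
    the argument is the vanishing of a Koszul cocycle.

    Assume that [X] is ACM. A form that vanishes on [Y] has a degree at least
    [d] unless it vanishes on [X], and modulo [I] it is a scalar multiple of
    [l ^ i m ^ j F] ([ideal_of_Y_multiple]). Hence the ideal of [Y] modulo [I]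
    is a free module of rank one over k[l, m] with basis [F], and comparing
    the action of [m] modulo [l] on R/I and on its quotient by this module shows
    that [Y] is ACM if and only if [F] is not in [I + (l, m)]
    ([ACM_remove_iff]).

    Next, suppose that [F] is not in [I + (l, m)]. Let [lP] and [mP] be the
    linear forms through [P]. Then [lP F] and [mP F] lie in [I], so they lift to
    vectors p and q of F1, and [mP p - lP q] is a syzygy of degree
    [d + (1, 1)]. If this degree did not occur in S2, then the syzygy would be
    in the irrelevant ideal times the module of syzygies. Reading this modulo
    [(l, m)] gives G in [I] such that [lP F = lP G], hence [F] would be in
    [I + (l, m)] ([separator_second_shift]).

    Conversely, suppose that [d + (1, 1)] is in S2. Then no form of degree [d]
    in [I] is nonzero at the point Z where [l] and [m] vanish
    ([form_notin_second_shifts]): such a form G can be used to correct the two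
    parts of a syzygy of degree [d + (1, 1)], and this writes the image of a
    basis vector of F2 as a combination of syzygies with coefficients in the
    irrelevant ideal. As k is infinite, [l] and [m] can be chosen so that [F] is
    nonzero at Z. If [F] were in [I + (l, m)], then the component of degree [d] of
    its part in [I] would be nonzero at Z. *)

(** * Regular sequences in a commutative ring *)
Section Ideals.
Variable A : comNzRingType.
Implicit Types (I J : A -> Prop) (a b f g h l m x : A).

Record is_ideal I : Prop := IsIdeal {
  ideal0 : I 0;
  idealD : forall a b, I a -> I b -> I (a + b);
  ideal_mull : forall a b, I b -> I (a * b) }.

Lemma idealN I a : is_ideal I -> I a -> I (- a).
Proof. by move=> hI Ia; rewrite -mulN1r; apply: ideal_mull. Qed.

Lemma idealB I a b : is_ideal I -> I a -> I b -> I (a - b).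
Proof. by move=> hI Ia Ib; apply: idealD => //; apply: idealN. Qed.

Lemma ideal_sum I (T : Type) (r : seq T) (p : pred T) (F : T -> A) :
  is_ideal I -> (forall i, p i -> I (F i)) -> I (\sum_(i <- r | p i) F i).
Proof.
move=> hI IF; apply: big_ind => //; first exact: ideal0.
by move=> a b; apply: idealD.
Qed.

Lemma ideal_mulr I a b : is_ideal I -> I a -> I (a * b).
Proof. by move=> hI Ia; rewrite mulrC; apply: ideal_mull. Qed.

(** The ideal generated by [I] and [f]; the form of the condition makes the
    coefficient of [f] directly available. *)
Definition adjoin I f h : Prop := exists a, I (h - a * f).

Lemma adjoin_ideal I f : is_ideal I -> is_ideal (adjoin I f).
Proof.
move=> hI; split.
- by exists 0; rewrite mul0r subrr; apply: ideal0.
- move=> a b [a' ha] [b' hb]; exists (a' + b').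
  by rewrite mulrDl opprD addrACA; apply: idealD.
- by move=> a b [b' hb]; exists (a * b'); rewrite -mulrA -mulrBr; apply: ideal_mull.
Qed.

Lemma sub_adjoin I f h : I h -> adjoin I f h.
Proof. by exists 0; rewrite mul0r subr0. Qed.

Lemma adjoin_gen I f a : is_ideal I -> adjoin I f (a * f).
Proof. by move=> hI; exists a; rewrite subrr; apply: ideal0. Qed.

Definition nzd I f : Prop := forall h, I (f * h) -> I h.

Lemma nzd_exp I f n h : nzd I f -> I (f ^+ n * h) -> I h.
Proof.
move=> ff; elim: n => [|n IHn]; first by rewrite expr0 mul1r.
by rewrite exprS -mulrA => /ff.
Qed.

(** If [l a = m b] modulo [I], then regularity of [m] modulo [l] makes [b] a
    multiple [l c], and [l] can be cancelled from [l a = l m c]. *)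
Lemma nzd_swap I l m :
  is_ideal I -> nzd I l -> nzd (adjoin I l) m -> nzd (adjoin I m) l.
Proof.
move=> hI hl hm a [b hb].
have [|c hc] := hm b.
  exists a; have -> : m * b - a * l = - (l * a - b * m) by ring.
  exact: idealN.
exists c; apply: hl.
have -> : l * (a - c * m) = (l * a - b * m) + m * (b - c * l) by ring.
by apply: idealD => //; apply: ideal_mull.
Qed.

(** Sending the class of [h] to the class of [a], where [f h = l a], is the usual
    isomorphism from the socle of A/(I + l) to that of A/(I + f). The second
    socle vanishes since it is killed by [g], which is regular modulo [f]. *)
Lemma nzd_exchange I l f g h : is_ideal I -> nzd I l ->
  nzd I f -> nzd (adjoin I f) g ->
  adjoin I l (f * h) -> adjoin I l (g * h) -> adjoin I l h.
Proof.
move=> hI hl hf hg [a ha] [b hb].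
have [|t ht] := hg a.
  exists b; apply: hl.
  have -> : l * (g * a - b * f)
    = f * (g * h - b * l) - g * (f * h - a * l) by ring.
  by apply: idealB => //; apply: ideal_mull.
exists t; apply: hf.
have -> : f * (h - t * l) = (f * h - a * l) + l * (a - t * f) by ring.
by apply: idealD => //; apply: ideal_mull.
Qed.

(** A socle element [s] of A/(I + (l, m)) defines a class in the second Koszul
    cohomology of A/I. Write [a s = ua l + va m] for a among [f], [g], [h]; then
    [b va - a vb = c_ab l] for some c_ab, which form a Koszul 2-cocycle. As
    [f], [g], [h] is a regular sequence, this cocycle is a coboundary, and
    subtracting the coboundary from the ua and va makes them divisible by a. So
    the class of [s] is zero. *)
Lemma depth_at_most_2 I l m f g h s : is_ideal I ->
  nzd I l -> nzd (adjoin I l) m ->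
  nzd I f -> nzd (adjoin I f) g -> nzd (adjoin (adjoin I f) g) h ->
  adjoin (adjoin I l) m (f * s) -> adjoin (adjoin I l) m (g * s) ->
  adjoin (adjoin I l) m (h * s) -> adjoin (adjoin I l) m s.
Proof.
move=> hI hl hm hf hg hh [vf [uf ef]] [vg [ug eg]] [vh [uh eh]].
have hml := nzd_swap hI hl hm.
have syz a b ua va ub vb : I (a * s - va * m - ua * l) ->
    I (b * s - vb * m - ub * l) ->
    exists c, I (b * va - a * vb - c * l) /\ I (b * ua - a * ub + c * m).
  move=> ea eb.
  have E : I (l * (b * ua - a * ub) + m * (b * va - a * vb)).
    have -> : l * (b * ua - a * ub) + m * (b * va - a * vb)
      = a * (b * s - vb * m - ub * l) - b * (a * s - va * m - ua * l) by ring.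
    by apply: idealB => //; apply: ideal_mull.
  have [|c hc] := hm (b * va - a * vb).
    exists (- (b * ua - a * ub)).
    by move: E; congr I; ring.
  exists c; split => //; apply: hl.
  have -> : l * (b * ua - a * ub + c * m)
    = (l * (b * ua - a * ub) + m * (b * va - a * vb))
      - m * (b * va - a * vb - c * l) by ring.
  by apply: idealB => //; apply: ideal_mull.
have [cfg [vfg ufg]] := syz _ _ _ _ _ _ ef eg.
have [cfh [vfh ufh]] := syz _ _ _ _ _ _ ef eh.
have [cgh [vgh ugh]] := syz _ _ _ _ _ _ eg eh.
have cocycle : I (h * cfg - g * cfh + f * cgh).
  apply: hl.
  have -> : l * (h * cfg - g * cfh + f * cgh) =
    g * (h * vf - f * vh - cfh * l) - h * (g * vf - f * vg - cfg * l)
    - f * (h * vg - g * vh - cgh * l) by ring.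
  by do 2 ?apply: idealB => //; apply: ideal_mull.
(* the cocycle is the coboundary of (bf, bg, bh) *)
have [|bf' [bg hb]] := hh cfg.
  exists cfh, (- cgh); move: cocycle; congr I; ring.
pose bf := - bf'.
have [|bh hbh] := hg (cfh + h * bf).
  exists (cgh + h * bg).
  have -> : g * (cfh + h * bf) - (cgh + h * bg) * f
    = h * (cfg - bf' * g - bg * f) - (h * cfg - g * cfh + f * cgh)
    by rewrite /bf; ring.
  by apply: idealB => //; apply: ideal_mull.
have [|s1 hs1] := hg (vf + l * bf).
  exists (vg + l * bg).
  have -> : g * (vf + l * bf) - (vg + l * bg) * f
    = (g * vf - f * vg - cfg * l) + l * (cfg - bf' * g - bg * f)
    by rewrite /bf; ring.
  by apply: idealD => //; apply: ideal_mull.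
have [|s2 hs2] := hg (uf - m * bf).
  exists (ug - m * bg).
  have -> : g * (uf - m * bf) - (ug - m * bg) * f
    = (g * uf - f * ug + cfg * m) - m * (cfg - bf' * g - bg * f)
    by rewrite /bf; ring.
  by apply: idealB => //; apply: ideal_mull.
exists s1, s2; apply: hf.
have -> : f * (s - s1 * m - s2 * l) = (f * s - vf * m - uf * l)
  + (m * (vf + l * bf - s1 * f) + l * (uf - m * bf - s2 * f)) by ring.
by do 2 ?apply: idealD => //; apply: ideal_mull.
Qed.

(** Treat the elements of [r] one after the other, multiplying [h] by the largest
    power of each that keeps it outside [J]. *)
Lemma exists_socle J (r : seq A) h : is_ideal J -> ~ J h ->
  (forall x, x \in r -> exists n, J (x ^+ n * h)) ->
  exists2 a, ~ J (a * h) & forall x, x \in r -> J (x * (a * h)).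
Proof.
move=> hJ; elim: r h => [|x r IHr] h Jh hr; first by exists 1; rewrite ?mul1r.
have [m Jm Jm1] : exists2 m, ~ J (x ^+ m * h) & J (x ^+ m.+1 * h).
  have [n] := hr x (mem_head _ _); elim: n => [|n IHn]; first by rewrite mul1r.
  by have [/IHn //|] := classic (J (x ^+ n * h)); exists n.
have [y yr|a Ja hra] := IHr (x ^+ m * h) Jm.
  have [|n Jn] := hr y; first by rewrite inE yr orbT.
  by exists n; rewrite mulrCA; apply: ideal_mull.
exists (a * x ^+ m) => [|y]; rewrite -mulrA //.
rewrite inE => /predU1P[->|/hra //].
by rewrite mulrCA [x * _]mulrA -exprS; apply: ideal_mull.
Qed.

End Ideals.

(** * Bihomogeneous components and restriction to planes *)
Section Grading.
Variable k : fieldType.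
Local Notation R := (biring k).
Implicit Types (F G : R) (d e : nat * nat) (u v z w : 'rV[k]_2) (s t : R).
Implicit Types (m : 'X_{1..2 + 2}) (i : 'I_2).

Definition bicomp d F : R := \sum_(m <- msupp F | bideg m == d) F@_m *: 'X_[m].

Lemma mcoeff_bicomp d F m : (bicomp d F)@_m = F@_m *+ (bideg m == d).
Proof.
rewrite /bicomp raddf_sum /= -big_filter.
under eq_bigr do rewrite mcoeffZ mcoeffX.
have [mF|mF] := boolP (m \in [seq m' <- msupp F | bideg m' == d]).
  rewrite (bigD1_seq m) ?filter_uniq //= eqxx mulr1 big1 ?addr0.
    by move: mF; rewrite mem_filter => /andP[-> _].
  by move=> m' /negbTE ->; rewrite mulr0.
rewrite big_seq big1; last first.
  by move=> m' /(memPn mF) /negbTE ->; rewrite mulr0.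
move: mF; rewrite mem_filter negb_and => /orP[/negbTE -> //|].
by rewrite -mcoeff_eq0 => /eqP ->; rewrite mul0rn.
Qed.

Lemma bihomogP d F : bihomog d F <-> forall m, F@_m != 0 -> bideg m = d.
Proof.
split=> [/allP h m|h]; first by rewrite -mcoeff_msupp => /h /eqP.
by apply/allP => m; rewrite mcoeff_msupp => /h ->.
Qed.

Lemma bihomog0 d : bihomog d (0 : R).
Proof. by apply/bihomogP => m; rewrite mcoeff0 eqxx. Qed.

Lemma bihomogD d F G : bihomog d F -> bihomog d G -> bihomog d (F + G).
Proof.
move=> /bihomogP hF /bihomogP hG; apply/bihomogP => m; rewrite mcoeffD.
by have [->|/hF //] := eqVneq F@_m 0; rewrite add0r => /hG.
Qed.

Lemma bihomogZ d c F : bihomog d F -> bihomog d (c *: F).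
Proof.
move=> /bihomogP hF; apply/bihomogP => m.
by rewrite mcoeffZ mulf_eq0 negb_or => /andP[_ /hF].
Qed.

Lemma bihomogB d F G : bihomog d F -> bihomog d G -> bihomog d (F - G).
Proof. by move=> hF hG; rewrite -scaleN1r; apply/bihomogD/bihomogZ. Qed.

Lemma bidegD m1 m2 : bideg (m1 + m2)%MM = bideg m1 + bideg m2.
Proof.
by rewrite /bideg; congr pair; rewrite -big_split /=;
   apply: eq_bigr => i _; rewrite mnmDE.
Qed.

Lemma bihomogM d e F G :
  bihomog d F -> bihomog e G -> bihomog (d + e) (F * G).
Proof.
move=> /bihomogP hF /bihomogP hG; apply/allP => m /msuppM_le /allpairsP.
case=> -[m1 m2] /= [m1F m2G ->]; rewrite bidegD.
by rewrite (hF m1) -?mcoeff_msupp // (hG m2) -?mcoeff_msupp.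
Qed.

Lemma bihomogX n d F : bihomog d F -> bihomog (d *+ n) (F ^+ n).
Proof.
move=> hF; elim: n => [|n IHn]; last by rewrite mulrS exprS; apply: bihomogM.
apply/bihomogP => m; rewrite mcoeff1; have [-> _|_] := eqVneq m 0%MM; last by rewrite eqxx.
by rewrite /bideg !big1 // => i _; rewrite mnm0E.
Qed.

Lemma bihomog_xy_exp F G a b : bihomog (1, 0)%N F -> bihomog (0, 1)%N G ->
  bihomog (a, b) (F ^+ a * G ^+ b).
Proof.
move=> hF hG.
have -> : (a, b) = (1, 0)%N *+ a + (0, 1)%N *+ b.
  have xE n : (1, 0)%N *+ n = (n, 0)%N by elim: n => // n IHn; rewrite mulrS IHn.
  have yE n : (0, 1)%N *+ n = (0, n)%N by elim: n => // n IHn; rewrite mulrS IHn.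
  by rewrite xE yE; congr pair; rewrite /= -[RHS]/(_ + _)%N ?addn0.
by apply: bihomogM; apply: bihomogX.
Qed.

Lemma bihomog_bicomp d F : bihomog d (bicomp d F).
Proof.
apply/bihomogP => m; rewrite mcoeff_bicomp.
by have [|_] := eqVneq (bideg m) d; rewrite ?eqxx.
Qed.

Lemma bicomp_is_zmod d : zmod_morphism (bicomp d).
Proof.
by move=> F G; apply/mpolyP => m; rewrite mcoeffB !mcoeff_bicomp mcoeffB mulrnBl.
Qed.

HB.instance Definition _ d :=
  GRing.isZmodMorphism.Build R R (bicomp d) (bicomp_is_zmod d).

Lemma bicomp_bihomog d e F : bihomog e F ->
  bicomp d F = if d == e then F else 0.
Proof.
move=> /bihomogP hF; apply/mpolyP => m; rewrite mcoeff_bicomp.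
have [Fm |/hF ->] := eqVneq F@_m 0; last first.
  by rewrite eq_sym; case: ifP; rewrite ?mcoeff0.
by rewrite Fm mul0rn; case: ifP; rewrite ?Fm ?mcoeff0.
Qed.

Definition bidegs F := undup [seq bideg m | m <- msupp F].

Lemma sum_bicomp F : \sum_(d <- bidegs F) bicomp d F = F.
Proof.
apply/mpolyP => m; rewrite raddf_sum /=.
under eq_bigr do rewrite mcoeff_bicomp.
have [mF|] := boolP (m \in msupp F); last first.
  by rewrite -mcoeff_eq0 => /eqP ->; rewrite big1 // => d _; rewrite mul0rn.
have mB : bideg m \in bidegs F by rewrite mem_undup map_f.
rewrite (bigD1_seq (bideg m)) ?undup_uniq //= eqxx mulr1n big1 ?addr0 //.
by move=> d; rewrite eq_sym => /negbTE ->.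
Qed.

(** Subtraction of degrees is truncated, whence the case distinction. *)
Lemma bicompM d e F G : bihomog e G ->
  bicomp d (G * F) =
  if bideg_le e d then G * bicomp (d.1 - e.1, d.2 - e.2)%N F else 0.
Proof.
move=> hG; rewrite -[in LHS](sum_bicomp F) big_distrr raddf_sum /=.
have hc f : bicomp d (G * bicomp f F) =
            if d == e + f then G * bicomp f F else 0.
  by apply: bicomp_bihomog; apply: bihomogM => //; apply: bihomog_bicomp.
under eq_bigr do rewrite hc.
case: ifPn => [/andP[le1 le2]|nle].
  have dE f : (d == e + f) = (f == (d.1 - e.1, d.2 - e.2)%N).
    apply/eqP/eqP => [->|->]; first by case: f => f1 f2; rewrite /= !addKn.
    by case: (d) (e) le1 le2 => [d1 d2] [e1 e2] /= le1 le2;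
       congr pair; rewrite /= -[RHS]/(_ + (_ - _))%N subnKC.
  under eq_bigr do rewrite dE.
  have [dF|dF] := boolP ((d.1 - e.1, d.2 - e.2)%N \in bidegs F).
    rewrite (bigD1_seq _ dF) ?undup_uniq //= eqxx big1 ?addr0 //.
    by move=> f /negbTE ->.
  rewrite big_seq big1 => [|f fF]; last by case: eqP => // fE; rewrite -fE fF in dF.
  rewrite (_ : bicomp _ F = 0) ?mulr0 //; apply/mpolyP => m.
  rewrite mcoeff_bicomp mcoeff0; case: eqP => // mE.
  apply/eqP; rewrite mulr1n mcoeff_eq0; apply: contraNN dF => mF.
  by rewrite -mE mem_undup map_f.
rewrite big1 // => f _; case: eqP => // dE.
by case/andP: nle; rewrite dE /= !leq_addr.
Qed.

(** The substitution x_i := u_i s, y_i := v_i t. For (u, v) on the cone over a point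
    and [s], [t] variables this is the restriction to the plane over that point;
    when [s], [t] are linear forms taking the value 1 at u and v, it is a
    retraction of R onto k[s, t]. *)
Definition along u v s t F : R :=
  F \mPo [tuple match split j with
                | inl i => u 0 i *: s | inr i => v 0 i *: t
                end | j < 2 + 2].

Lemma along_is_zmod u v s t : zmod_morphism (along u v s t).
Proof. exact: raddfB. Qed.
HB.instance Definition _ u v s t :=
  GRing.isZmodMorphism.Build R R (along u v s t) (along_is_zmod u v s t).
Lemma along_is_monoid u v s t : monoid_morphism (along u v s t).
Proof. by split; [exact: rmorph1 | exact: rmorphM]. Qed.
HB.instance Definition _ u v s t :=
  GRing.isMonoidMorphism.Build R R (along u v s t) (along_is_monoid u v s t).
Lemma along_is_scalable u v s t : scalable (along u v s t).
Proof. by move=> a F; rewrite /along linearZ. Qed.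
HB.instance Definition _ u v s t :=
  GRing.isScalable.Build k R R *:%R (along u v s t) (along_is_scalable u v s t).

Lemma alongX u v s t m : along u v s t 'X_[m]
  = eval_vec u v 'X_[m] *: (s ^+ (bideg m).1 * t ^+ (bideg m).2).
Proof.
rewrite /along comp_mpolyX /eval_vec mevalX !big_split_ord /= -!prodrXr.
rewrite -scalerA scalerAr scalerAl -!scaler_prod.
congr (_ * _); apply: eq_bigr => i _; rewrite tnth_mktuple.
  by rewrite (unsplitK (inl i)) row_mxEl exprZn.
by rewrite (unsplitK (inr i)) row_mxEr exprZn.
Qed.

Lemma along_bihomog u v s t d F : bihomog d F ->
  along u v s t F = eval_vec u v F *: (s ^+ d.1 * t ^+ d.2).
Proof.
move=> /allP hF; rewrite [in LHS](mpolyE F) /eval_vec [in RHS](mpolyE F).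
rewrite !raddf_sum scaler_suml /= big_seq [RHS]big_seq; apply: eq_bigr => m /hF /eqP <-.
by rewrite linearZ /= alongX mevalZ scalerA.
Qed.

(** A substitution acts as the identity modulo an ideal that contains the
    differences between the variables and their images. *)
Lemma comp_mpoly_cong (J : R -> Prop) (lq : (2 + 2).-tuple R) F : is_ideal J ->
  (forall j, J ('X_j - tnth lq j)) -> J (F - (F \mPo lq)).
Proof.
move=> hJ hX.
have hM G H : J (G - (G \mPo lq)) -> J (H - (H \mPo lq)) ->
    J (G * H - ((G * H) \mPo lq)).
  move=> hG hH; rewrite rmorphM /=; set G' := G \mPo lq; set H' := H \mPo lq.
  have -> : G * H - G' * H' = (G - G') * H + G' * (H - H') by ring.
  by apply: idealD => //; [apply: ideal_mulr|apply: ideal_mull].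
rewrite (mpolyE F) [X in _ - X]raddf_sum -sumrB /=; apply: ideal_sum => // m _.
rewrite linearZ -scalerBr /= -mul_mpolyC; apply: ideal_mull => //.
rewrite mpolyXE_id.
elim/big_ind: _ => [|G H|j _]; last 2 first.
- exact: hM.
- elim: (m j) => [|n IHn]; last first.
    by rewrite exprS; apply: hM => //; rewrite comp_mpolyXU -tnth_nth.
  by rewrite rmorph1 subrr; apply: ideal0.
by rewrite rmorph1 subrr; apply: ideal0.
Qed.

Lemma along_cong (J : R -> Prop) u v s t F : is_ideal J ->
  (forall i, J ('X_(lshift 2 i) - u 0 i *: s)) ->
  (forall i, J ('X_(rshift 2 i) - v 0 i *: t)) ->
  J (F - along u v s t F).
Proof.
move=> hJ hu hv; apply: comp_mpoly_cong => // j; rewrite tnth_mktuple.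
by case: (split_ordP j) => i ->.
Qed.

Local Notation ix := (lshift 2 (0 : 'I_2)).
Local Notation iy := (rshift 2 (0 : 'I_2)).
Local Notation x0 := ('X_ix : R).
Local Notation y0 := ('X_iy : R).

(** The variables x_0 and y_0 serve as the coordinates of the plane, so that the
    target of the restriction is again R, an integral domain. *)
Definition restrict u v F : R := along u v x0 y0 F.

(** The plane over a point sees the values of all bihomogeneous components
    separately; this is what makes membership in the ideal of a set of points a
    condition on all of F. *)
Lemma mcoeff_restrict u v d F :
  (restrict u v F)@_(U_(ix) *+ d.1 + U_(iy) *+ d.2)%MM
  = eval_vec u v (bicomp d F).
Proof.
rewrite /restrict /eval_vec (mpolyE F).
rewrite [along _ _ _ _ _]raddf_sum [bicomp _ _]raddf_sum.
rewrite [LHS]raddf_sum [RHS]raddf_sum /=. apply: eq_bigr => m _.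
have hm : bihomog (bideg m) (F@_m *: 'X_[m] : R).
  by apply/bihomogZ/bihomogP => m'; rewrite mcoeffX; have [->|_] := eqVneq m m'; rewrite ?eqxx.
rewrite (along_bihomog _ _ _ _ hm) (bicomp_bihomog _ hm) mcoeffZ.
rewrite !mpolyXn -mpolyXD mcoeffX /eval_vec.
suff -> : (U_(ix) *+ (bideg m).1 + U_(iy) *+ (bideg m).2 ==
           U_(ix) *+ d.1 + U_(iy) *+ d.2)%MM = (d == bideg m).
  by case: eqP; rewrite ?mulr1 // mulr0 meval0.
apply/eqP/eqP => [/mnmP hE|-> //].
have := hE ix; have := hE iy.
rewrite !mnmDE !mulmnE !mnm1E !eqxx !eq_lrshift !eq_rlshift /= !mul0n !mul1n.
rewrite !add0n !addn0 => e2 e1.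
by rewrite [d]surjective_pairing -e1 -e2.
Qed.

Lemma restrict_eq0 u v F :
  restrict u v F = 0 <-> forall d, eval_vec u v (bicomp d F) = 0.
Proof.
split=> [F0 d|F0]; first by rewrite -mcoeff_restrict F0 mcoeff0.
rewrite -(sum_bicomp F) /restrict [LHS]raddf_sum big1 //= => d _.
by rewrite (along_bihomog _ _ _ _ (bihomog_bicomp d F)) F0 scale0r.
Qed.

Lemma along_eq0 u v s t F : restrict u v F = 0 -> along u v s t F = 0.
Proof.
move=> /restrict_eq0 F0; rewrite -(sum_bicomp F) [LHS]raddf_sum big1 //= => d _.
by rewrite (along_bihomog _ _ _ _ (bihomog_bicomp d F)) F0 scale0r.
Qed.

Lemma ideal_genP (S J : R -> Prop) F :
  is_ideal J -> (forall G, S G -> J G) -> ideal_gen S F -> J F.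
Proof.
move=> hJ SJ [n [a [g [gS ->]]]]; apply: ideal_sum => // i _.
by apply: ideal_mull => //; apply: SJ.
Qed.

Lemma sub_ideal_gen (S : R -> Prop) F : S F -> ideal_gen S F.
Proof.
by exists 1%N, (fun=> 1), (fun=> F); split=> //; rewrite big_ord1 mul1r.
Qed.

Lemma ideal_gen_ideal (S : R -> Prop) : is_ideal (ideal_gen S).
Proof.
split.
- by exists 0%N, (fun=> 0), (fun=> 0); split=> [[]|]; rewrite ?big_ord0.
- move=> F G [n [a [f [fS ->]]]] [p [b [g [gS ->]]]].
  exists (n + p)%N,
    (fun j => match split j with inl i => a i | inr i => b i end),
    (fun j => match split j with inl i => f i | inr i => g i end).
  split=> [j|]; first by case: split.
  rewrite big_split_ord; congr (_ + _); apply: eq_bigr => i _.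
    by rewrite (unsplitK (inl i)).
  by rewrite (unsplitK (inr i)).
- move=> F G [n [a [f [fS ->]]]]; exists n, (fun j => F * a j), f; split=> //.
  by rewrite big_distrr; apply: eq_bigr => i _; rewrite /= mulrA.
Qed.

Definition cx (P : P1P1 k) : 'rV[k]_2 := vpick (val P.1).
Definition cy (P : P1P1 k) : 'rV[k]_2 := vpick (val P.2).

Lemma cx_neq0 P : cx P != 0.
Proof. by rewrite vpick0 -dimv_eq0; case: P.1 => /= U /eqP ->. Qed.

Lemma cy_neq0 P : cy P != 0.
Proof. by rewrite vpick0 -dimv_eq0; case: P.2 => /= U /eqP ->. Qed.

(** The ideal of [X] is the intersection of the kernels of the restrictions to the
    planes over its points. *)
Lemma ideal_ofP (X : {fset P1P1 k}) F :
  ideal_of X F <-> forall P, P \in X -> restrict (cx P) (cy P) F = 0.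
Proof.
split=> [XF P PX|F0].
  move: XF; apply: (ideal_genP (J := fun F => restrict (cx P) (cy P) F = 0)).
    rewrite /restrict; split=> [|G H hG hH|G H hH]; first exact: raddf0.
      by rewrite raddfD /= hG hH addr0.
    by rewrite rmorphM /= hH mulr0.
  move=> G [[d hG] G0]; rewrite /restrict (along_bihomog _ _ _ _ hG).
  by rewrite -/(eval_at P G) G0 ?scale0r.
rewrite -(sum_bicomp F); apply: ideal_sum; first exact: ideal_gen_ideal.
move=> d _; apply: sub_ideal_gen; split; first by exists d; apply: bihomog_bicomp.
by move=> P /F0 /restrict_eq0 /(_ d).
Qed.

Lemma ideal_of_ideal (X : {fset P1P1 k}) : is_ideal (ideal_of X).
Proof. exact: ideal_gen_ideal. Qed.

Lemma ideal_of_bihomog (X : {fset P1P1 k}) d F : bihomog d F ->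
  (ideal_of X F <-> forall P, P \in X -> eval_at P F = 0).
Proof.
move=> hF; split; last first.
  by move=> F0; apply: sub_ideal_gen; split=> //; exists d.
move=> /ideal_ofP XF P /XF /restrict_eq0 /(_ d).
by rewrite (bicomp_bihomog _ hF) eqxx.
Qed.

Lemma ideal_of_bicomp (X : {fset P1P1 k}) d F :
  ideal_of X F -> ideal_of X (bicomp d F).
Proof.
move=> /ideal_ofP XF; apply/(ideal_of_bihomog _ (bihomog_bicomp d F)) => P /XF.
by move/restrict_eq0/(_ d).
Qed.

End Grading.

(** * Nonvanishing of polynomials over an algebraically closed field *)
Section Nonroot.
Variable k : closedFieldType.

Lemma muni_eq0 n (F : {mpoly k[n.+1]}) : muni F = 0 -> F = 0.
Proof.
move=> F0; apply/mpolyP => m; rewrite mcoeff0.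
pose low (m' : 'X_{1..n.+1}) := [multinom m' (widen_ord (leqnSn n) i) | i < n].
have lowE m' : low m' = low m -> m' ord_max = m ord_max -> m' = m.
  move=> /mnmP lE maxE; apply/mnmP => j.
  have [i|] := unliftP ord_max j; last by move=> ->.
  have := lE i; rewrite !mnmE => lEi ->.
  rewrite (_ : lift ord_max i = widen_ord (leqnSn n) i) //.
  by apply: val_inj; rewrite /= /bump leqNgt ltn_ord.
have := congr1 (fun p : {poly {mpoly k[n]}} => p`_(m ord_max)@_(low m)) F0.
rewrite coef0 mcoeff0 muniE coef_sum raddf_sum /=.
under eq_bigr => m' _.
  rewrite coefZ coefXn mulr_natr mcoeffMn mcoeffZ mcoeffX.
  rewrite -/(low m') mulr_natr -mulrnA mulnb.
  have -> : (low m' == low m) && (m ord_max == m' ord_max) = (m' == m).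
    by apply/andP/eqP => [[/eqP lE /eqP mE]|->//]; apply: lowE.
  over.
have [mF|mF] := boolP (m \in msupp F); last first.
  by move: mF; rewrite -mcoeff_eq0 => /eqP.
rewrite (bigD1_seq m) ?msupp_uniq //= eqxx big1 ?addr0 //.
by move=> m' /negbTE ->.
Qed.

Lemma meval_muni n (F : {mpoly k[n.+1]}) (v : 'I_n.+1 -> k) :
  F.@[v] = (map_poly (meval (fun i => v (widen_ord (leqnSn n) i))) (muni F)).[v ord_max].
Proof.
rewrite muniE raddf_sum horner_sum mevalE; apply: eq_bigr => m _.
rewrite /= -mul_polyC rmorphM /= map_polyC map_polyXn hornerM hornerC hornerXn.
rewrite [RHS]/= mevalZ mevalX -mulrA big_ord_recr; congr (_ * (_ * _)).
by apply: eq_bigr => i _; rewrite mnmE.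
Qed.

Lemma exists_meval_neq0 n (F : {mpoly k[n]}) : F != 0 -> exists v, F.@[v] != 0.
Proof.
elim: n F => [|n IHn] F F0.
  exists (fun=> 0); apply: contraNneq F0; rewrite [F]nvar0_mpolyC mevalC => ->.
  by rewrite mpolyC0.
have [|v hv] := IHn (lead_coef (muni F)).
  by rewrite lead_coef_eq0; apply: contraNneq F0 => /muni_eq0 ->.
have /closed_nonrootP[c hc] : map_poly (meval v) (muni F) != 0.
  apply: contraNneq hv => F0'.
  by rewrite lead_coefE -coef_map /= F0' coef0.
exists (fun i => if unlift ord_max i is Some j then v j else c).
rewrite meval_muni unlift_none.
rewrite (eq_map_poly (g := meval v)) // => G; apply: meval_eq => i.
rewrite (_ : widen_ord _ i = lift ord_max i) ?liftK //.
by apply: val_inj; rewrite /= /bump leqNgt ltn_ord.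
Qed.

End Nonroot.

(** * Linear forms and the ideal of a point *)
Section Forms.
Variable k : fieldType.
Local Notation R := (biring k).
Implicit Types (F G : R) (d : nat * nat) (u v z w : 'rV[k]_2) (s t : R).
Implicit Types (X : {fset P1P1 k}) (P Q : P1P1 k).

Definition det2 u z : k := u 0 0 * z 0 1 - u 0 1 * z 0 0.

(** The linear form that vanishes at [u], in the x's or in the y's according to the
    embedding [e] of the indices. *)
Definition linform (e : 'I_2 -> 'I_(2 + 2)) u : R :=
  u 0 0 *: 'X_(e 1) - u 0 1 *: 'X_(e 0).
Definition xform := linform (@lshift 2 2).
Definition yform := linform (@rshift 2 2).

Lemma det2C u z : det2 u z = - det2 z u.
Proof. by rewrite /det2; ring. Qed.

Lemma det2uu u : det2 u u = 0.
Proof. by rewrite /det2; ring. Qed.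

Lemma ord2P (i : 'I_2) : {i = 0} + {i = 1}.
Proof.
by case: i => [[|[|//]] lti]; [left|right]; apply: val_inj.
Qed.

Lemma row2_neq0 u : u != 0 -> (u 0 0 != 0) || (u 0 1 != 0).
Proof.
apply: contraNT; rewrite negb_or !negbK => /andP[/eqP u0 /eqP u1].
by apply/eqP/rowP => i; rewrite mxE; case: (ord2P i) => ->.
Qed.

Lemma bihomog_xvar i : bihomog (1, 0)%N ('X_(lshift 2 i) : R).
Proof.
apply/bihomogP => m; rewrite mcoeffX; have [<- _|_] := eqVneq U_(lshift 2 i)%MM m;
  last by rewrite eqxx.
rewrite /bideg !big_ord_recl !big_ord0 !mnm1E !eq_lshift !eq_lrshift.
by case: (ord2P i) => ->.
Qed.

Lemma bihomog_yvar i : bihomog (0, 1)%N ('X_(rshift 2 i) : R).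
Proof.
apply/bihomogP => m; rewrite mcoeffX; have [<- _|_] := eqVneq U_(rshift 2 i)%MM m;
  last by rewrite eqxx.
rewrite /bideg !big_ord_recl !big_ord0 !mnm1E !eq_rshift !eq_rlshift.
by case: (ord2P i) => ->.
Qed.

Lemma bihomog_xform u : bihomog (1, 0)%N (xform u).
Proof. by apply: bihomogB; apply/bihomogZ/bihomog_xvar. Qed.

Lemma bihomog_yform u : bihomog (0, 1)%N (yform u).
Proof. by apply: bihomogB; apply/bihomogZ/bihomog_yvar. Qed.

Lemma eval_xform z w u : eval_vec z w (xform u) = det2 u z.
Proof. by rewrite /eval_vec mevalB !mevalZ !mevalXU !row_mxEl. Qed.

Lemma eval_yform z w v : eval_vec z w (yform v) = det2 v w.
Proof. by rewrite /eval_vec mevalB !mevalZ !mevalXU !row_mxEr. Qed.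

Lemma along_xform z w s t u : along z w s t (xform u) = det2 u z *: s.
Proof.
by rewrite (along_bihomog _ _ _ _ (bihomog_xform u)) eval_xform mulr1.
Qed.

Lemma along_yform z w s t v : along z w s t (yform v) = det2 v w *: t.
Proof.
by rewrite (along_bihomog _ _ _ _ (bihomog_yform v)) eval_yform mul1r.
Qed.

Lemma linform_span e u z i : det2 u z != 0 ->
  'X_(e i) = (z 0 i / det2 u z) *: linform e u
           - (u 0 i / det2 u z) *: linform e z.
Proof.
move=> uz; rewrite ![_ / _]mulrC -!scalerA -scalerBr.
apply: (canRL (scalerK uz)); rewrite /linform /det2; case: (ord2P i) => ->;
  by rewrite -!mul_mpolyC !mpolyCB !mpolyCM; ring.
Qed.

(** A linear form with value 1 at [z]: the inverse of a nonzero coordinate of [z]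
    times the corresponding variable. *)
Lemma linform_dual e z : z != 0 -> exists2 a : 'rV[k]_2,
  a 0 0 * z 0 0 + a 0 1 * z 0 1 = 1 &
  forall i, exists c,
    'X_(e i) - z 0 i *: (a 0 0 *: 'X_(e 0) + a 0 1 *: 'X_(e 1)) = c *: linform e z.
Proof.
move=> /row2_neq0 /orP[z0|z1].
  exists ((z 0 0)^-1 *: delta_mx 0 0); rewrite !mxE /= ?mulr1 ?mulr0 ?mul0r ?addr0.
    by rewrite mulVf.
  move=> i; exists ((i == 1)%:R * (z 0 0)^-1).
  case: (ord2P i) => -> /=; rewrite ?mul0r ?mul1r scale0r ?addr0 scalerA.
    by rewrite mulfV // scale1r subrr scale0r.
  by rewrite /linform scalerBr !scalerA mulVf // scale1r mulrC.
exists ((z 0 1)^-1 *: delta_mx 0 1); rewrite !mxE /= ?mulr1 ?mulr0 ?mul0r ?add0r.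
  by rewrite mulVf.
move=> i; exists (- ((i == 0)%:R * (z 0 1)^-1)).
case: (ord2P i) => -> /=; rewrite ?mul0r ?mul1r scale0r ?add0r scalerA.
  by rewrite /linform scaleNr scalerBr !scalerA mulVf // scale1r opprB mulrC.
by rewrite mulfV // scale1r subrr oppr0 scale0r.
Qed.

Lemma exists_xdual z : z != 0 -> exists x : R,
  [/\ bihomog (1, 0)%N x, forall w, eval_vec z w x = 1 &
      forall i, exists c, 'X_(lshift 2 i) - z 0 i *: x = c *: xform z].
Proof.
move=> /(linform_dual (@lshift 2 2)) [a a1 ha].
exists (a 0 0 *: 'X_(lshift 2 0) + a 0 1 *: 'X_(lshift 2 1)); split=> // [|w].
  by apply: bihomogD; apply/bihomogZ/bihomog_xvar.
by rewrite /eval_vec mevalD !mevalZ !mevalXU !row_mxEl.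
Qed.

Lemma exists_ydual w : w != 0 -> exists y : R,
  [/\ bihomog (0, 1)%N y, forall z, eval_vec z w y = 1 &
      forall i, exists c, 'X_(rshift 2 i) - w 0 i *: y = c *: yform w].
Proof.
move=> /(linform_dual (@rshift 2 2)) [a a1 ha].
exists (a 0 0 *: 'X_(rshift 2 0) + a 0 1 *: 'X_(rshift 2 1)); split=> // [|z].
  by apply: bihomogD; apply/bihomogZ/bihomog_yvar.
by rewrite /eval_vec mevalD !mevalZ !mevalXU !row_mxEr.
Qed.

(** The ideal (l, m) of the point Z = (z, w). *)
Definition point_ideal z w : R -> Prop :=
  adjoin (adjoin (fun F => F = 0) (xform z)) (yform w).

Lemma zero_ideal : is_ideal (fun F : R => F = 0).
Proof.
by split=> // [F G -> ->|F G ->]; rewrite ?addr0 ?mulr0.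
Qed.

Lemma point_ideal_ideal z w : is_ideal (point_ideal z w).
Proof. by do 2 apply: adjoin_ideal; apply: zero_ideal. Qed.

Lemma point_idealP z w F :
  point_ideal z w F <-> exists a b, F = a * xform z + b * yform w.
Proof.
split=> [[b [a /eqP]]|[a [b ->]]].
  by rewrite -addrA -opprD subr_eq0 addrC => /eqP ->; exists a, b.
by exists b, a; rewrite addrK subrr.
Qed.

Lemma point_ideal_x z w a : point_ideal z w (a *: xform z).
Proof. by apply/point_idealP; exists a%:MP, 0; rewrite mul0r addr0 mul_mpolyC. Qed.

Lemma point_ideal_y z w a : point_ideal z w (a *: yform w).
Proof. by apply/point_idealP; exists 0, a%:MP; rewrite mul0r add0r mul_mpolyC. Qed.

(** Modulo (l, m) a polynomial is congruent to its restriction to the plane over Z,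
    expressed in linear forms [x], [y] with value 1 at Z. *)
Lemma point_ideal_restrict z w F : z != 0 -> w != 0 ->
  point_ideal z w F <-> restrict z w F = 0.
Proof.
move=> z0 w0; split=> [/point_idealP [a [b ->]]|F0].
  rewrite /restrict raddfD /= !rmorphM /= along_xform along_yform !det2uu.
  by rewrite !scale0r !mulr0 addr0.
have [x [_ _ hx]] := exists_xdual z0; have [y [_ _ hy]] := exists_ydual w0.
rewrite -[F]subr0 -(along_eq0 x y F0); apply: along_cong => [|i|i].
- exact: point_ideal_ideal.
- by have [c ->] := hx i; apply: point_ideal_x.
- by have [c ->] := hy i; apply: point_ideal_y.
Qed.

Lemma point_ideal_bihomog z w d F : z != 0 -> w != 0 -> bihomog d F ->
  point_ideal z w F <-> eval_vec z w F = 0.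
Proof.
move=> z0 w0 hF; rewrite point_ideal_restrict // restrict_eq0; split=> [/(_ d)|F0 e].
  by rewrite (bicomp_bihomog _ hF) eqxx.
by rewrite (bicomp_bihomog _ hF); case: eqP => // _; rewrite /eval_vec meval0.
Qed.

Lemma irrelevantP F : irrelevant F <-> F@_0%MM = 0.
Proof.
split; first apply: (ideal_genP (J := fun F => F@_0%MM = 0)).
- split=> [|G H hG hH|G H hH]; first exact: mcoeff0.
    by rewrite mcoeffD hG hH addr0.
  by rewrite rmorphM /= hH mulr0.
- move=> G [i ->]; rewrite mcoeffX; case: eqP => // /mnmP /(_ i).
  by rewrite mnm1E eqxx mnm0E.
move=> F0; rewrite (mpolyE F) big_seq; apply: ideal_sum => [|m mF].
  exact: ideal_gen_ideal.
have [i mi] : exists i, m i != 0%N.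
  apply/existsP; apply: contraT; rewrite negb_exists => /forallP m0.
  have mE : m = 0%MM by apply/mnmP => i; rewrite mnm0E; apply/eqP/negPn/m0.
  by move: mF; rewrite mE mcoeff_msupp F0 eqxx.
have -> : m = (m - U_(i) + U_(i))%MM by rewrite submK // lep1mP.
rewrite mpolyXD scalerAl; apply: ideal_mull; first exact: ideal_gen_ideal.
by apply: sub_ideal_gen; exists i.
Qed.

Lemma irrelevant_bihomog d F : d <> (0, 0)%N -> bihomog d F -> irrelevant F.
Proof.
move=> d0 /bihomogP hF; apply/irrelevantP/eqP/negPn/negP => /hF.
by rewrite /bideg !big1 => [/esym //|i _|i _]; rewrite mnm0E.
Qed.

End Forms.

(** * A criterion for arithmetic Cohen-Macaulayness *)
Section Depth.
Variable k : fieldType.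
Local Notation R := (biring k).
Implicit Types (F G : R) (d : nat * nat) (u v z w : 'rV[k]_2) (s t : R).
Implicit Types (X : {fset P1P1 k}) (P Q : P1P1 k) (I J : R -> Prop).

(** The two lines through Z = (z, w) contain no point of [X]. *)
Record generic X z w : Prop := Generic {
  generic_x0 : z != 0;
  generic_y0 : w != 0;
  generic_x : forall Q, Q \in X -> det2 (cx Q) z != 0;
  generic_y : forall Q, Q \in X -> det2 (cy Q) w != 0 }.

Lemma idealZ J a F : is_ideal J -> J F -> J (a *: F).
Proof. by move=> hJ JF; rewrite -mul_mpolyC; apply: ideal_mull. Qed.

Lemma var_neq0 (j : 'I_(2 + 2)) : 'X_j != 0 :> R.
Proof.
apply/eqP => /(congr1 (mcoeff U_(j))).
by rewrite mcoeffX eqxx mcoeff0 => /eqP; rewrite oner_eq0.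
Qed.

Lemma nzd_xform X z w : generic X z w -> nzd (ideal_of X) (xform z).
Proof.
move=> gen F /ideal_ofP hF; apply/ideal_ofP => Q QX.
have := hF Q QX; rewrite /restrict rmorphM /= along_xform.
move/eqP; rewrite mulf_eq0 scaler_eq0 det2C oppr_eq0.
by rewrite (negbTE (generic_x gen QX)) (negbTE (var_neq0 _)) => /eqP.
Qed.

(** The variables are combinations of the forms that vanish at [u] and at [z]. *)
Lemma ideal_var J (e : 'I_2 -> 'I_(2 + 2)) u z (i : 'I_2) G : is_ideal J ->
  det2 u z != 0 -> J (linform e z) -> J (linform e u * G) -> J ('X_(e i) * G).
Proof.
move=> hJ uz Jz JuG.
rewrite (linform_span _ _ uz) mulrBl; apply: idealB => //.
  by rewrite -scalerAl; apply: idealZ.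
by apply: ideal_mulr => //; apply: idealZ.
Qed.

Lemma ideal_var_exp J (e : 'I_2 -> 'I_(2 + 2)) (T : eqType) (r : seq T)
    (c : T -> 'rV_2) z (i : 'I_2) G :
  is_ideal J -> J (linform e z) -> (forall q, q \in r -> det2 (c q) z != 0) ->
  J (\prod_(q <- r) linform e (c q) * G) -> J ('X_(e i) ^+ size r * G).
Proof.
move=> hJ Jz; elim: r G => [|q r IHr] G hr; first by rewrite big_nil.
rewrite big_cons -mulrA => /(ideal_var i hJ (hr q (mem_head _ _)) Jz).
rewrite mulrCA => /IHr; rewrite exprSr -mulrA; apply=> q' q'r.
by apply: hr; rewrite inE q'r orbT.
Qed.

(** The product of the vertical lines through the points of [X] is in the ideal of
    [X], and modulo [l] the variable is a scalar multiple of each of these lines. *)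
Lemma xvar_nilpotent X z w J i : generic X z w -> is_ideal J ->
  (forall F, ideal_of X F -> J F) -> J (xform z) ->
  exists n, J ('X_(lshift 2 i) ^+ n).
Proof.
move=> gen hJ IJ Jz; exists (size X); rewrite -[_ ^+ _]mulr1.
apply: (ideal_var_exp i (r := X) (c := @cx k) hJ Jz) => //; first exact: (generic_x gen).
rewrite mulr1; apply/IJ/ideal_ofP => Q QX.
rewrite /restrict rmorph_prod /= (big_rem Q) //=.
by rewrite along_xform det2uu scale0r mul0r.
Qed.

Lemma yvar_nilpotent X z w J i : generic X z w -> is_ideal J ->
  (forall F, ideal_of X F -> J F) -> J (yform w) ->
  exists n, J ('X_(rshift 2 i) ^+ n).
Proof.
move=> gen hJ IJ Jw; exists (size X); rewrite -[_ ^+ _]mulr1.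
apply: (ideal_var_exp i (r := X) (c := @cy k) hJ Jw) => //; first exact: (generic_y gen).
rewrite mulr1; apply/IJ/ideal_ofP => Q QX.
rewrite /restrict rmorph_prod /= (big_rem Q) //=.
by rewrite along_yform det2uu scale0r mul0r.
Qed.

Lemma irrelevant_mul J F a : is_ideal J ->
  (forall i, J ('X_i * a)) -> irrelevant F -> J (F * a).
Proof.
move=> hJ Ja; apply: (ideal_genP (J := fun F => J (F * a))) => [|G [i ->] //].
split=> [|G H hG hH|G H hH]; first by rewrite mul0r; apply: ideal0.
  by rewrite mulrDl; apply: idealD.
by rewrite -mulrA; apply: ideal_mull.
Qed.

Lemma ideal_plus_nil I F : is_ideal I -> ideal_plus I [::] F <-> I F.
Proof.
move=> hI; split; last by move=> IF; apply: sub_ideal_gen; left.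
by apply: ideal_genP => // G [].
Qed.

Lemma ideal_plus_cons I f (s : seq R) F : is_ideal I ->
  ideal_plus I (f :: s) F <-> ideal_plus (adjoin I f) s F.
Proof.
move=> hI; split; apply: ideal_genP; try exact: ideal_gen_ideal; move=> G [].
- by move=> IG; apply: sub_ideal_gen; left; apply: sub_adjoin.
- rewrite inE => /predU1P[->|Gs]; apply: sub_ideal_gen; last by right.
  by left; rewrite -[X in adjoin _ _ X]mul1r; apply: adjoin_gen.
- case=> a ha; rewrite -[G](subrK (a * f)).
  apply: idealD; [exact: ideal_gen_ideal| |apply: ideal_mull; first exact: ideal_gen_ideal].
    by apply: sub_ideal_gen; left.
  by apply: sub_ideal_gen; right; apply: mem_head.
- by move=> Gs; apply: sub_ideal_gen; right; rewrite inE Gs orbT.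
Qed.

(** Adjoining the elements of the sequence one at a time gives nested [adjoin]'s,
    to which the results on [nzd] apply. *)
Lemma regular_seq_nzd I (s : seq R) :
  regular_seq I s -> is_ideal I -> forall i, (i < size s)%N ->
  nzd (foldl (@adjoin R) I (take i s)) s`_i.
Proof.
case=> _ hs _ hI i ltis.
have foldlE (r : seq R) F : ideal_plus I r F <-> foldl (@adjoin R) I r F.
  elim: r I hI {hs} => [|f r IHr] I hI /=; first exact: ideal_plus_nil.
  by rewrite ideal_plus_cons // IHr //; apply: adjoin_ideal.
by move=> F /foldlE /(hs _ _ ltis) /foldlE.
Qed.

Lemma eval_vec0 F : eval_vec 0 0 F = F@_0%MM.
Proof.
have irr0 G : irrelevant G -> eval_vec 0 0 G = 0.
  apply: (ideal_genP (J := fun G => eval_vec 0 0 G = 0)) => [|H [i ->]].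
    rewrite /eval_vec; split=> [|H H' hH hH'|H H' hH]; first exact: meval0.
      by rewrite mevalD hH hH' addr0.
    by rewrite mevalM hH mulr0.
  by rewrite /eval_vec mevalXU row_mx0 mxE.
have /irr0/eqP : irrelevant (F - (F@_0%MM)%:MP).
  by apply/irrelevantP; rewrite mcoeffB mcoeffC eqxx mulr1 subrr.
by rewrite /eval_vec mevalB mevalC subr_eq0 => /eqP.
Qed.

Lemma ideal_of_irrelevant X Q F : Q \in X -> ideal_of X F -> irrelevant F.
Proof.
move=> QX; apply: ideal_genP => [|G [[d hG] G0]]; first exact: ideal_gen_ideal.
apply/irrelevantP; rewrite -eval_vec0.
have := bihomog_eval_scale 0 0 (cx Q) (cy Q) hG.
by rewrite !scale0r => ->; rewrite -/(eval_at Q G) G0 ?mulr0.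
Qed.

Lemma ideal_of_fset0 F : ideal_of (fset0 : {fset P1P1 k}) F.
Proof. by apply/ideal_ofP => Q; rewrite in_fset0. Qed.

(** A zero divisor [F] of [m] modulo I + (l) is killed by powers of all variables:
    by powers of the x's since these are in I + (l), and by powers of the y's
    since these are in I + (l, m). So a multiple of [F] is a nonzero socle
    element modulo I + (l), which contradicts depth 2. *)
Lemma ACM_nzd X z w : generic X z w ->
  ACM X -> nzd (adjoin (ideal_of X) (xform z)) (yform w).
Proof.
move=> gen [->|[[s [reg size_s]] _]] F.
  by move=> _; apply: sub_adjoin; apply: ideal_of_fset0.
set I := ideal_of X; set J := adjoin I (xform z) => JF.
have hI : is_ideal I by apply: ideal_of_ideal.
have hJ : is_ideal J by apply: adjoin_ideal.
case: (classic (J F)) => // nJF.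
case: s reg size_s => [|f [|g []]] // reg _.
have hf := regular_seq_nzd reg hI (i := 0) isT.
have hg := regular_seq_nzd reg hI (i := 1) isT.
have [irr _ _] := reg.
have [_ /mapP[j _ ->]|a nJa Ja] :=
    @exists_socle _ J [seq 'X_i | i <- enum 'I_(2 + 2)] F hJ nJF.
  have IJ G : I G -> J G by apply: sub_adjoin.
  have [[i ->]|[i ->]] : (exists i, j = lshift 2 i) \/ (exists i, j = rshift 2 i).
    by case: (split_ordP j) => i ->; [left|right]; exists i.
    have Jx : J (xform z) by rewrite -[X in J X]mul1r; apply: adjoin_gen.
    have [n Jn] := xvar_nilpotent i gen hJ IJ Jx.
    by exists n; apply: ideal_mulr.
  have hJm := adjoin_ideal (yform w) hJ.
  have Jy : adjoin J (yform w) (yform w).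
    by rewrite -[X in adjoin _ _ X]mul1r; apply: adjoin_gen.
  have [|n [b Jn]] := yvar_nilpotent i gen hJm _ Jy.
    by move=> G IG; apply/sub_adjoin/IJ.
  exists n; rewrite -[_ ^+ n](subrK (b * yform w)) mulrDl -mulrA.
  by apply: idealD => //; [apply: ideal_mulr|apply: ideal_mull].
have Jirr G : irrelevant G -> J (G * (a * F)).
  apply: irrelevant_mul => // j; apply: Ja.
  by apply: map_f; rewrite mem_enum.
case: nJa; apply: (nzd_exchange hI _ hf hg); first exact: (nzd_xform gen).
  by apply/Jirr/irr; rewrite mem_head.
by apply/Jirr/irr; rewrite inE mem_head orbT.
Qed.

(** Here [l], [m] is a regular sequence. Modulo it all variables are nilpotent, so
    there is a socle element, and no regular sequence can have length 3. *)
Lemma nzd_ACM X z w : generic X z w ->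
  nzd (adjoin (ideal_of X) (xform z)) (yform w) -> ACM X.
Proof.
move=> gen hy; have [->|[Q QX]] := fset_0Vmem X; first by left.
set I := ideal_of X in hy; set K := adjoin (adjoin I (xform z)) (yform w).
have hI : is_ideal I by apply: ideal_of_ideal.
have hJ : is_ideal (adjoin I (xform z)) by apply: adjoin_ideal.
have hK : is_ideal K by apply: adjoin_ideal.
have irr_x : irrelevant (xform z).
  exact: irrelevant_bihomog (bihomog_xform z).
have irr_y : irrelevant (yform w).
  exact: irrelevant_bihomog (bihomog_yform w).
have nK1 : ~ K 1.
  case=> b [a /(ideal_of_irrelevant QX) h1].
  have hR : is_ideal (@irrelevant k) by apply: ideal_gen_ideal.
  have : irrelevant (1 : R).
    rewrite -[1](subrK (b * yform w)); apply: idealD => //; last exact: ideal_mull.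
    rewrite -[_ - _](subrK (a * xform z)); apply: idealD => //.
    exact: ideal_mull.
  by move/irrelevantP/eqP; rewrite mcoeff1 eqxx oner_eq0.
have IK G : I G -> K G by move=> IG; apply/sub_adjoin/sub_adjoin.
right; split; last first.
  move=> s reg; rewrite leqNgt; apply/negP => lt2s.
  case: s lt2s reg => [|f [|g [|h s]]] // _ reg.
  have hf := regular_seq_nzd reg hI (i := 0) isT.
  have hg := regular_seq_nzd reg hI (i := 1) isT.
  have hh := regular_seq_nzd reg hI (i := 2) isT.
  have [irr _ _] := reg.
  have [_ /mapP[j _ ->]|a] :=
    @exists_socle _ K [seq 'X_i | i <- enum 'I_(2 + 2)] 1 hK nK1.
    have [[i ->]|[i ->]] : (exists i, j = lshift 2 i) \/ (exists i, j = rshift 2 i).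
      by case: (split_ordP j) => i ->; [left|right]; exists i.
    - have [|n Kn] := xvar_nilpotent i gen hK IK; last by exists n; rewrite mulr1.
      by rewrite -[X in K X]mul1r; apply/sub_adjoin/adjoin_gen.
    - have [|n Kn] := yvar_nilpotent i gen hK IK; last by exists n; rewrite mulr1.
      by rewrite -[X in K X]mul1r; apply: adjoin_gen.
  rewrite mulr1 => nKa Ka; apply: nKa.
  have Kirr G : irrelevant G -> K (G * a).
    apply: irrelevant_mul => // j; apply: Ka.
    by apply: map_f; rewrite mem_enum.
  apply: (depth_at_most_2 hI (nzd_xform gen) hy hf hg hh);
    by apply/Kirr/irr; rewrite !inE eqxx ?orbT.
exists [:: xform z; yform w]; split=> //; split.
- by move=> F; rewrite !inE => /orP[] /eqP ->.
- case=> [|[|//]] F _ /=.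
    by rewrite !ideal_plus_nil //; apply: (nzd_xform gen).
  by rewrite !ideal_plus_cons // !ideal_plus_nil //; apply: hy.
- by rewrite !ideal_plus_cons // ideal_plus_nil.
Qed.

End Depth.

Lemma linform_neq0 (k : fieldType) (e : 'I_2 -> 'I_(2 + 2)) (u : 'rV[k]_2) :
  e 0 != e 1 -> u != 0 -> linform e u != 0.
Proof.
move=> e01; apply: contraNneq => f0; have := row2_neq0 (u := u); case: eqP => // _.
have /(congr1 (mcoeff U_(e 1))) := f0; have /(congr1 (mcoeff U_(e 0))) := f0.
rewrite !mcoeffB !mcoeffZ !mcoeffXU !eqxx [e 1 == _]eq_sym (negbTE e01) !mulr0 !mulr1 !mcoeff0.
by rewrite sub0r subr0 => /eqP; rewrite oppr_eq0 => /eqP -> ->; rewrite eqxx => /(_ isT).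
Qed.

Lemma xform_neq0 (k : fieldType) (P : P1P1 k) : xform (cx P) != 0.
Proof. by apply: linform_neq0 => //; apply: cx_neq0. Qed.

Lemma yform_neq0 (k : fieldType) (P : P1P1 k) : yform (cy P) != 0.
Proof. by apply: linform_neq0 => //; apply: cy_neq0. Qed.

Lemma exists_generic (k : closedFieldType) (X : {fset P1P1 k}) (F : biring k) :
  F != 0 -> exists z w, generic X z w /\ eval_vec z w F != 0.
Proof.
move=> F0.
(* A nonroot (z, w) of this product avoids the zeros of [F] and the lines through
   the points of [X]; the two variables force z and w to be nonzero when [X] is
   empty. *)
pose H := F * ('X_(lshift 2 0) * 'X_(rshift 2 0)) *
          \prod_(Q <- X) (xform (cx Q) * yform (cy Q)).
have [|v Hv] := @exists_meval_neq0 k _ H.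
  rewrite !mulf_neq0 ?var_neq0 // prodf_seq_neq0; apply/allP => Q _ /=.
  by apply: mulf_neq0; [apply: xform_neq0|apply: yform_neq0].
pose z : 'rV[k]_2 := \row_i v (lshift 2 i).
pose w : 'rV[k]_2 := \row_i v (rshift 2 i).
have vE G : G.@[v] = eval_vec z w G.
  apply: meval_eq => j; case: (split_ordP j) => i ->.
    by rewrite row_mxEl mxE.
  by rewrite row_mxEr mxE.
move: Hv; rewrite !mevalM rmorph_prod /= !mevalXU !mulf_eq0 !negb_or.
case/andP => /andP[Fv /andP[x0 y0]]; rewrite prodf_seq_neq0 => /allP Xv.
exists z, w; split; last by rewrite -vE.
split.
- by apply: contraNneq x0 => /rowP/(_ 0); rewrite !mxE => ->.
- by apply: contraNneq y0 => /rowP/(_ 0); rewrite !mxE => ->.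
- move=> Q /Xv /=; rewrite mevalM mulf_eq0 negb_or => /andP[].
  by rewrite !vE eval_xform.
- move=> Q /Xv /=; rewrite mevalM mulf_eq0 negb_or => /andP[_].
  by rewrite !vE eval_yform.
Qed.

(** * Removing a point from an ACM set *)
Section Separators.
Variables (k : fieldType) (X : {fset P1P1 k}) (P : P1P1 k).
Variables (d : nat * nat) (F : biring k) (z w : 'rV[k]_2).
Local Notation R := (biring k).
Local Notation Y := (X `\ P)%fset.
Local Notation I := (ideal_of X).
Local Notation l := (xform z).
Local Notation m := (yform w).
Implicit Types (G H : R) (e : nat * nat).

Hypotheses (PX : P \in X) (gen : generic X z w) (hdeg : in_deg X P d).
Hypotheses (sepF : separator X P F) (hF : bihomog d F).

Let hI : is_ideal I := ideal_of_ideal X.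
Let hIY : is_ideal (ideal_of Y) := ideal_of_ideal Y.

Lemma sub_ideal_of G : I G -> ideal_of Y G.
Proof.
move=> /ideal_ofP XG; apply/ideal_ofP => Q; rewrite in_fsetD1 => /andP[_ QX].
exact: XG.
Qed.

Lemma generic_sub : generic Y z w.
Proof.
by case: gen => z0 w0 hx hy; split=> // Q; rewrite in_fsetD1 => /andP[_ QX];
   [apply: hx|apply: hy].
Qed.

Lemma separator_neq0 : eval_at P F != 0.
Proof. by case: sepF. Qed.

Lemma separator_mem : ideal_of Y F.
Proof. by apply/(ideal_of_bihomog _ hF); case: sepF. Qed.

Lemma ideal_of_vanish e G : bihomog e G -> ideal_of Y G -> eval_at P G = 0 -> I G.
Proof.
move=> hG /(ideal_of_bihomog _ hG) YG PG; apply/(ideal_of_bihomog _ hG) => Q QX.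
have [->//|QP] := eqVneq Q P; apply: YG.
by rewrite in_fsetD1 QP.
Qed.

(** Forms of degree strictly below [d] do not separate [P], by the minimality of
    [d]. *)
Lemma small_degree e G : bihomog e G -> ideal_of Y G -> bideg_le e d -> e != d ->
  I G.
Proof.
move=> hG YG led ned; apply: (ideal_of_vanish hG YG).
apply/eqP; apply: contraNT ned => PG; apply/eqP.
apply: (proj2 hdeg) => //; exists G => //; split=> //; first by exists e.
exact/(ideal_of_bihomog _ hG).
Qed.

Lemma eval_xform_neq0 Q : Q \in X -> eval_at Q l != 0.
Proof.
by move=> QX; rewrite /eval_at eval_xform det2C oppr_eq0 (generic_x gen QX).
Qed.

Lemma eval_yform_neq0 Q : Q \in X -> eval_at Q m != 0.
Proof.
by move=> QX; rewrite /eval_at eval_yform det2C oppr_eq0 (generic_y gen QX).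
Qed.

Lemma eval_atM Q G H : eval_at Q (G * H) = eval_at Q G * eval_at Q H.
Proof. exact: mevalM. Qed.
Lemma eval_atB Q G H : eval_at Q (G - H) = eval_at Q G - eval_at Q H.
Proof. exact: mevalB. Qed.
Lemma eval_atZ Q a G : eval_at Q (a *: G) = a * eval_at Q G.
Proof. exact: mevalZ. Qed.
Lemma eval_atXn Q G n : eval_at Q (G ^+ n) = eval_at Q G ^+ n.
Proof. exact: rmorphXn. Qed.

Lemma separator_notin : ~ I F.
Proof.
move=> /(ideal_of_bihomog _ hF) /(_ _ PX) /eqP.
by rewrite (negbTE separator_neq0).
Qed.

(** A quotient of [F] by [f] modulo [I] would have a component that is a separator
    of degree strictly below [d]. *)
Lemma separator_undivisible f e : bihomog e f -> e != (0, 0)%N ->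
  (forall Q, Q \in X -> eval_at Q f != 0) -> ~ adjoin I f F.
Proof.
move=> hf e0 fX [a /(ideal_of_bicomp d)].
rewrite raddfB /= (bicomp_bihomog _ hF) eqxx mulrC (bicompM _ _ hf).
case: ifPn => [led|_]; last by rewrite subr0 => /separator_notin.
set a' := bicomp _ a.
have ha' : bihomog (d.1 - e.1, d.2 - e.2)%N a' by apply: bihomog_bicomp.
have hfa : bihomog d (F - f * a').
  apply: bihomogB => //; have := bihomogM hf ha'; congr bihomog.
  case: (d) (e) led => [d1 d2] [e1 e2] /andP[/= le1 le2].
  by congr pair; rewrite /= -[LHS]/(_ + (_ - _))%N subnKC.
move=> /(ideal_of_bihomog _ hfa) XF.
have evE Q : Q \in X -> eval_at Q F = eval_at Q f * eval_at Q a'.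
  by move=> /XF /eqP; rewrite eval_atB eval_atM subr_eq0 => /eqP.
have Ia : I a'.
  apply: (small_degree ha').
  - apply/(ideal_of_bihomog _ ha') => Q; rewrite in_fsetD1 => /andP[QP QX].
    have := evE Q QX; case: sepF => _ _ ->; last by rewrite in_fsetD1 QP.
    by move/esym/eqP; rewrite mulf_eq0 (negbTE (fX Q QX)) => /eqP.
  - by rewrite /bideg_le !leq_subr.
  - apply: contraNneq e0; case: (d) (e) led => [d1 d2] [e1 e2] /andP[/= le1 le2].
    by case=> eq1 eq2; apply/eqP; congr pair; lia.
have := evE P PX; rewrite (proj1 (ideal_of_bihomog _ ha') Ia) // mulr0.
by move/eqP; rewrite (negbTE separator_neq0).
Qed.

Hypothesis ACM_X : nzd (adjoin I l) m.

Lemma separator_notin_x : ~ adjoin I l F.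
Proof.
by apply: (separator_undivisible (bihomog_xform z)) => //; apply: eval_xform_neq0.
Qed.

Lemma separator_notin_y : ~ adjoin I m F.
Proof.
by apply: (separator_undivisible (bihomog_yform w)) => //; apply: eval_yform_neq0.
Qed.

Lemma ideal_of_proportional e G H :
  bihomog e G -> bihomog e H -> ideal_of Y G -> ideal_of Y H ->
  I (eval_at P H *: G - eval_at P G *: H).
Proof.
move=> hG hH YG YH; apply: (@ideal_of_vanish e).
- by apply: bihomogB; apply: bihomogZ.
- by apply: idealB => //; apply: idealZ.
- by rewrite eval_atB !eval_atZ mulrC subrr.
Qed.

Let bihomog_lm a b : bihomog (a, b) (l ^+ a * m ^+ b).
Proof. exact: bihomog_xy_exp (bihomog_xform z) (bihomog_yform w). Qed.

Lemma eval_xy_exp_neq0 Q a b : Q \in X -> eval_at Q (l ^+ a * m ^+ b) != 0.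
Proof.
move=> QX; rewrite eval_atM !eval_atXn mulf_neq0 ?expf_neq0 //.
  exact: eval_xform_neq0.
exact: eval_yform_neq0.
Qed.

(** Suppose that [G] separates [P] and that the degrees of [F] and [G] are
    incomparable, say e_1 < d_1 and d_2 < e_2. Then a power of [m] times [F] and a
    power of [l] times [G] have the same degree and are proportional modulo [I].
    As [m] is regular modulo I + (l), this puts [F] in I + (l). *)
Lemma separator_deg_ge e G : bihomog e G -> ideal_of Y G -> eval_at P G != 0 ->
  bideg_le d e.
Proof.
move=> hG YG PG; rewrite /bideg_le.
have key a b a' b' : (a + d.1 = a' + e.1)%N -> (b + d.2 = b' + e.2)%N ->
    exists c, I (l ^+ a * m ^+ b * F - c *: (l ^+ a' * m ^+ b' * G)).
  move=> eq1 eq2.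
  have h1 : bihomog (a + d.1, b + d.2)%N (l ^+ a * m ^+ b * F).
    exact: bihomogM (bihomog_lm a b) hF.
  have h2 : bihomog (a + d.1, b + d.2)%N (l ^+ a' * m ^+ b' * G).
    rewrite eq1 eq2; exact: bihomogM (bihomog_lm a' b') hG.
  have := ideal_of_proportional h1 h2 (ideal_mull hIY _ separator_mem) (ideal_mull hIY _ YG).
  set u := eval_at P (l ^+ a' * m ^+ b' * G); set v := eval_at _ _.
  have u0 : u != 0 by rewrite /u eval_atM mulf_neq0 ?eval_xy_exp_neq0.
  move=> /(idealZ u^-1 hI); rewrite scalerBr !scalerA mulVf // scale1r.
  by exists (u^-1 * v).
have incomparable : ~~ ((e.1 <= d.1)%N && (e.2 <= d.2)%N && (e != d)).
  apply/negP => /andP[led ned]; move/negP: PG; apply; apply/eqP.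
  have /(ideal_of_bihomog _ hG) := small_degree hG YG led ned.
  exact.
apply/andP; split; rewrite leqNgt; apply/negP => lt.
  have [lt2|le2] := ltnP d.2 e.2; last first.
    case/negP: incomparable; rewrite le2 (ltnW lt) /=.
    by apply: contraTneq lt => ->; rewrite ltnn.
  have [||c] := key 0%N (e.2 - d.2)%N (d.1 - e.1)%N 0%N; [lia..|].
  rewrite expr0 mul1r mulr1 => hc; apply: separator_notin_x.
  apply: (nzd_exp (n := (e.2 - d.2)) ACM_X).
  exists (c *: (l ^+ (d.1 - e.1).-1 * G)).
  rewrite -scalerAl mulrAC -exprSr prednK ?subn_gt0 //.
have [lt1|le1] := ltnP d.1 e.1; last first.
  case/negP: incomparable; rewrite le1 (ltnW lt) /=.
  by apply: contraTneq lt => ->; rewrite ltnn.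
have [||c] := key (e.1 - d.1)%N 0%N 0%N (d.2 - e.2)%N; [lia..|].
rewrite expr0 mul1r mulr1 => hc; apply: separator_notin_y.
apply: (nzd_exp (n := (e.1 - d.1)) (nzd_swap hI (nzd_xform gen) ACM_X)).
exists (c *: (m ^+ (d.2 - e.2).-1 * G)).
by rewrite -scalerAl mulrAC -exprSr prednK ?subn_gt0.
Qed.

(** Modulo [I], every form vanishing on [Y] is a scalar times l^i m^j F. The
    conclusion keeps apart the part with i = j = 0. *)
Lemma ideal_of_Y_multiple G : ideal_of Y G ->
  exists c a b, I (G - (c *: F + a * (l * F) + b * (m * F))).
Proof.
pose K G := exists c a b, I (G - (c *: F + a * (l * F) + b * (m * F))).
have K0 G' : I G' -> K G'.
  by move=> IG; exists 0, 0, 0; rewrite scale0r !mul0r !addr0 subr0.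
move=> YG; rewrite -(sum_bicomp G) -/(K _); elim/big_ind: _ => [|A B|e _].
- by apply: K0; apply: ideal0.
- move=> [c [a [b hA]]] [c' [a' [b' hB]]]; exists (c + c'), (a + a'), (b + b').
  have := idealD hI hA hB; congr I; rewrite scalerDl.
  move: (c *: F) (c' *: F) (l * F) (m * F) => f1 f2 f3 f4. ring.
have hG := bihomog_bicomp e G; have {}YG := ideal_of_bicomp e YG.
move: (bicomp e G) hG YG => {}G hG YG.
have [PG|PG] := eqVneq (eval_at P G) 0; first by apply: K0; apply: (ideal_of_vanish hG).
have /andP[le1 le2] := separator_deg_ge hG YG PG.
pose a := (e.1 - d.1)%N; pose b := (e.2 - d.2)%N.
have hM : bihomog e (l ^+ a * m ^+ b * F).
  have := bihomogM (bihomog_lm a b) hF; congr bihomog.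
  rewrite [RHS]surjective_pairing; congr pair; rewrite /= -[LHS]/(_ + _)%N subnK //.
have := ideal_of_proportional hG hM YG (ideal_mull hIY _ separator_mem).
set u := eval_at P (l ^+ a * m ^+ b * F); set v := eval_at _ _.
have u0 : u != 0 by rewrite /u eval_atM mulf_neq0 ?eval_xy_exp_neq0 ?separator_neq0.
move=> /(idealZ u^-1 hI); rewrite scalerBr !scalerA mulVf // scale1r.
move: (u^-1 * v) => c.
case: (a) => [|i].
  case: (b) => [|j] hc.
    exists c, 0, 0; move: hc; rewrite !expr0 !mul1r.
    by rewrite !mul0r !addr0.
  exists 0, 0, (c *: m ^+ j); move: hc; rewrite expr0 mul1r exprSr -mulrA scalerAl.
  by rewrite scale0r mul0r !add0r.
move=> hc; exists 0, (c *: (l ^+ i * m ^+ b)), 0; move: hc.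
have -> : l ^+ i.+1 * m ^+ b * F = l ^+ i * m ^+ b * (l * F) by rewrite exprSr; ring.
by rewrite scalerAl scale0r mul0r add0r addr0.
Qed.

(** If F = a l + b m modulo [I] and [Y] is ACM, then [b] is in I_Y + (l), and the
    component of degree d - (0, 1) of its I_Y-part is in [I]; so [F] is in I + (l),
    contrary to the minimality of [d]. Conversely, a relation expressing [m G]
    by [l] modulo I_Y holds modulo [I] up to c F + a l F + b m F, and c = 0
    because [F] is not in I + (l, m); then b m F can be absorbed in [m G]. *)
Lemma ACM_remove_iff : ACM Y <-> ~ adjoin (adjoin I l) m F.
Proof.
split=> [acmY [b [a hab]]|nF].
  have hYl := adjoin_ideal l hIY.
  have [c hc] : adjoin (ideal_of Y) l b.
    apply: (ACM_nzd generic_sub acmY); exists (- a).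
    have -> : m * b - - a * l = F - (F - b * m - a * l) by ring.
    by apply: idealB => //; [apply: separator_mem|apply: sub_ideal_of].
  set n := b - c * l in hc.
  have {}hab : I (F - l * (m * c + a) - m * n).
    by move: hab; congr I; rewrite /n; ring.
  have := ideal_of_bicomp d hab.
  rewrite !raddfB /= (bicomp_bihomog _ hF) eqxx.
  rewrite (bicompM d _ (bihomog_xform z)) (bicompM d _ (bihomog_yform w)).
  have In : I (if bideg_le (0, 1)%N d then
      m * bicomp (d.1 - (0, 1).1, d.2 - (0, 1).2)%N n else 0).
    case: ifP => [/andP[_ /= d2]|_]; last exact: ideal0.
    apply: ideal_mull => //; apply: small_degree.
    - exact: bihomog_bicomp.
    - exact: ideal_of_bicomp.
    - by rewrite /bideg_le !leq_subr.
    - by apply/negP => /eqP /(congr1 snd) /=; move: d2; lia.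
  move=> /(idealD hI)/(_ In); rewrite subrK.
  case: ifP => _; last by rewrite subr0 => /separator_notin.
  set a' := bicomp _ _; move=> hFa; apply: separator_notin_x.
  by exists a'; rewrite mulrC.
apply: (nzd_ACM generic_sub) => G [h /ideal_of_Y_multiple [c [a [b hab]]]].
have [c0|c0] := eqVneq c 0; last first.
  case: nF; exists (c^-1 *: (G - b * F)), (c^-1 *: (- h - a * F)).
  have := idealN hI (idealZ c^-1 hI hab); congr I.
  have FE : F = c^-1%:MP * (c *: F).
    by rewrite mul_mpolyC scalerA mulVf // scale1r.
  rewrite -!(mul_mpolyC c^-1) [X in _ = X - _ - _]FE.
  by move: (c^-1%:MP) (c *: F) => q cF; ring.
have /ACM_X [g hg] : adjoin I l (m * (G - b * F)).
  by exists (h + a * F); move: hab; rewrite c0 scale0r add0r; congr I; ring.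
exists g; have -> : G - g * l = G - b * F - g * l + b * F by ring.
by apply: idealD => //; [apply: sub_ideal_of|apply: ideal_mull => //; apply: separator_mem].
Qed.

End Separators.

(** * Bigraded free modules *)
Section GradedModules.
Variable k : fieldType.
Local Notation R := (biring k).
Implicit Types (n : nat) (D E e : nat * nat).

(** The component of degree [D] of a vector of the free module with shifts [S]. *)
Definition row_comp n (S : n.-tuple (nat * nat)) D (v : 'rV[R]_n) : 'rV[R]_n :=
  \row_j if bideg_le (tnth S j) D
         then bicomp (D.1 - (tnth S j).1, D.2 - (tnth S j).2)%N (v 0 j) else 0.

Lemma bideg_subE D E e : (bideg_le E D && ((D.1 - E.1, D.2 - E.2)%N == e)) = (E + e == D).
Proof.
case: D E e => [a b] [a' b'] [a'' b'']; rewrite /bideg_le /=.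
apply/andP/eqP => [[/andP[le1 le2] /eqP [<- <-]]|[<- <-]].
  by congr pair; rewrite /= -[LHS]/(_ + _)%N subnKC.
by rewrite !leq_addr !addKn.
Qed.

Lemma row_comp_is_zmod n (S : n.-tuple (nat * nat)) D :
  zmod_morphism (row_comp S D).
Proof.
move=> u v; apply/rowP => j; rewrite !mxE; case: ifP => _; last by rewrite subr0.
exact: raddfB.
Qed.
HB.instance Definition _ n (S : n.-tuple (nat * nat)) D :=
  GRing.isZmodMorphism.Build 'rV[R]_n 'rV[R]_n (row_comp S D)
    (row_comp_is_zmod S D).

Lemma free_homog_row_comp n (S : n.-tuple (nat * nat)) D v :
  free_homog S D (row_comp S D v).
Proof.
move=> j; rewrite mxE; case: ifP => [le|_]; [right|by left].
exists (D.1 - (tnth S j).1, D.2 - (tnth S j).2)%N; split; last exact: bihomog_bicomp.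
by apply/esym/eqP; rewrite -bideg_subE le eqxx.
Qed.

Lemma row_comp_homog n (S : n.-tuple (nat * nat)) D E v :
  free_homog S E v -> row_comp S D v = if E == D then v else 0.
Proof.
move=> hv; apply/rowP => j; rewrite mxE.
have -> : (if E == D then v else 0) 0 j = if E == D then v 0 j else 0.
  by case: ifP; rewrite ?mxE.
case: (hv j) => [->|[e [-> he]]]; first by rewrite raddf0 !if_same.
rewrite (bicomp_bihomog _ he) -bideg_subE.
by case: bideg_le.
Qed.

(** Graded maps commute with taking components. Stated for an arbitrary target, with
    [g] as the projection on the component of degree [D], since the target is R
    for the first map of a resolution and a module of rows for the second. *)
Lemma graded_row_comp n (S : n.-tuple (nat * nat)) D (V : zmodType)
    (f : {additive 'rV[R]_n -> V}) (g : {additive V -> V}) v :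
  (forall E u, free_homog S E u -> g (f u) = if E == D then f u else 0) ->
  g (f v) = f (row_comp S D v).
Proof.
move=> hfg; rewrite (row_sum_delta v) !raddf_sum; apply: eq_bigr => j _ /=.
rewrite -(sum_bicomp (v 0 j)) scaler_suml !raddf_sum; apply: eq_bigr => e _ /=.
have hu : free_homog S (tnth S j + e) (bicomp e (v 0 j) *: delta_mx 0 j).
  move=> i; rewrite !mxE eqxx /=; have [->|_] := eqVneq i j; last by rewrite mulr0; left.
  by right; exists e; rewrite mulr1; split=> //; apply: bihomog_bicomp.
by rewrite (hfg _ _ hu) (row_comp_homog _ hu); case: ifP; rewrite ?raddf0.
Qed.

End GradedModules.

Lemma shift_cancel (d a b c e f : nat * nat) :
  d + (a + b) = c + e -> e = a + f -> d + b = c + f.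
Proof.
move=> eq1 ef; move: eq1; rewrite ef {e ef}.
case: d a b c f => [d d'] [a a'] [b b'] [c c'] [f f'].
rewrite -!/((_ + _)%N, (_ + _)%N) => -[eq1 eq2]; congr pair.
  by move: eq1; rewrite /= -!/(addn _ _); lia.
by move: eq2; rewrite /= -!/(addn _ _); lia.
Qed.

Lemma regroup_syzygies (V : zmodType) (p q a b c e : V) :
  p - q = a + b + c + e -> p - c = q + a + b + e.
Proof.
move/(canRL (subrK q)) ->.
by rewrite [_ + q]addrC [a + b + c + e]addrAC !addrA addrK.
Qed.

(** * The second syzygies *)
Section Resolution.
Variables (k : fieldType) (X : {fset P1P1 k}) (n1 n2 : nat).
Variables (S1 : n1.-tuple (nat * nat)) (S2 : n2.-tuple (nat * nat)).
Variable d1 : {linear 'rV[biring k]_n1 -> (biring k)^o}.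
Variable d2 : {linear 'rV[biring k]_n2 -> 'rV[biring k]_n1}.
Variables (z w : 'rV[k]_2).
Local Notation R := (biring k).
Local Notation I := (ideal_of X).
Local Notation l := (xform z).
Local Notation m := (yform w).
Implicit Types (F G H : R) (d e : nat * nat).

Hypotheses (hres : minimal_resolution I S1 S2 d1 d2) (gen : generic X z w).

Let hI : is_ideal I := ideal_of_ideal X.

Lemma d1Z a v : d1 (a *: v) = a * d1 v :> R.
Proof. by rewrite linearZ_LR. Qed.

Lemma d1D u v : d1 (u + v) = d1 u + d1 v :> R.
Proof. exact: linearD. Qed.

Lemma d1B u v : d1 (u - v) = d1 u - d1 v :> R.
Proof. exact: linearB. Qed.

Lemma I_d1 v : I (d1 v).
Proof. by apply/(res_exact0 hres); exists v. Qed.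

Lemma d1_I F : I F -> exists v, d1 v = F.
Proof. by move/(res_exact0 hres). Qed.

Lemma syzygyP v : d1 v = 0 -> exists u, d2 u = v.
Proof. by move/(res_exact1 hres). Qed.

Lemma d1d2 u : d1 (d2 u) = 0 :> R.
Proof. by apply/(res_exact1 hres); exists u. Qed.

(** Substituting x_i := z_i x, with [x] a linear form of value 1 at z, and keeping the
    y's kills exactly the multiples of [l] and fixes [m]; so [B] is a multiple of
    [l]. *)
Lemma forms_regular A B : A * l + B * m = 0 -> exists h, A = h * m /\ B = - h * l.
Proof.
move=> AB0; have [x [_ x1 hx]] := exists_xdual (generic_x0 gen).
pose lq : (2 + 2).-tuple R :=
  [tuple match split j with inl i => z 0 i *: x | inr i => 'X_(rshift 2 i) end | j < 2 + 2].
pose J := adjoin (fun F : R => F = 0) l.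
have hJ : is_ideal J by apply/adjoin_ideal/zero_ideal.
have hlq : forall j, J ('X_j - tnth lq j).
  move=> j; rewrite tnth_mktuple; case: (split_ordP j) => i ->.
    have [c ->] := hx i; apply: idealZ => //.
    by rewrite -[X in J X]mul1r; apply: adjoin_gen; apply: zero_ideal.
  by rewrite subrr; apply: ideal0.
have lqx i : 'X_(lshift 2 i) \mPo lq = z 0 i *: x.
  by rewrite comp_mpolyXU -tnth_nth tnth_mktuple (unsplitK (inl i)).
have lqy i : 'X_(rshift 2 i) \mPo lq = 'X_(rshift 2 i).
  by rewrite comp_mpolyXU -tnth_nth tnth_mktuple (unsplitK (inr i)).
have l0 : l \mPo lq = 0.
  by rewrite /xform /linform raddfB /= !comp_mpolyZ !lqx !scalerA mulrC subrr.
have mE : m \mPo lq = m.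
  by rewrite /yform /linform raddfB /= !comp_mpolyZ !lqy.
have m0 : m != 0 by apply: linform_neq0 => //; apply: (generic_y0 gen).
have B0 : B \mPo lq = 0.
  have /eqP := congr1 (comp_mpoly lq) AB0.
  rewrite raddf0 raddfD /= !rmorphM /= l0 mulr0 add0r mE mulf_eq0 (negbTE m0).
  by rewrite orbF => /eqP.
have [h hB] : J B by have := comp_mpoly_cong B hJ hlq; rewrite B0 subr0.
have l0' : l != 0 by apply: linform_neq0 => //; apply: (generic_x0 gen).
have BE : B = h * l by apply/eqP; rewrite -subr_eq0 hB.
exists (- h); split; last by rewrite opprK.
apply: (mulIf l0'); apply/eqP; rewrite -subr_eq0; apply/eqP.
by rewrite -AB0 BE; ring.
Qed.

Hypothesis ACM_X : nzd (adjoin I l) m.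

(** The intersection of [I] and (l, m) is (l, m) I, as l, m is regular on R/I. *)
Lemma point_ideal_I F : I F -> point_ideal z w F ->
  exists u v, F = l * d1 u + m * d1 v.
Proof.
move=> IF /point_idealP [a [b FE]].
have [c hc] : adjoin I l b.
  by apply: ACM_X; exists (- a); rewrite mulNr opprK mulrC addrC -FE.
have Iac : I (a + c * m).
  apply: (nzd_xform gen).
  have -> : l * (a + c * m) = F - m * (b - c * l) by rewrite FE; ring.
  by apply: idealB => //; apply: ideal_mull.
have [u uE] := d1_I Iac; have [v vE] := d1_I hc.
by exists u, v; rewrite uE vE FE; ring.
Qed.

Lemma free_homog_delta n (S : n.-tuple (nat * nat)) (j : 'I_n) :
  free_homog S (tnth S j) (delta_mx 0 j : 'rV[R]_n).
Proof.
move=> i; rewrite mxE eqxx /=; have [->|_] := eqVneq i j; last by left.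
right; exists 0; rewrite addr0; split=> //.
exact: (bihomogX 0 (@bihomog0 k 0)).
Qed.

(** Modulo (l, m) a form of degree [e] is its value at Z times x^e_1 y^e_2, and a
    power of [x] or, failing that, of [y] can be split off because F has no
    constant term. *)
Lemma split_irrelevant e F (x y : R) :
  bihomog (1, 0)%N x -> bihomog (0, 1)%N y ->
  (forall v, eval_vec z v x = 1) -> (forall u, eval_vec u w y = 1) ->
  bihomog e F -> irrelevant F ->
  exists A B a b,
  [/\ F = x * A + y * B + l * a + m * b,
      A = 0 \/ exists e', e = (1, 0)%N + e' /\ bihomog e' A &
      B = 0 \/ exists e', e = (0, 1)%N + e' /\ bihomog e' B].
Proof.
move=> hx hy x1 y1 hF irr; set c := eval_vec z w F.
have split_off A B : bihomog e (x * A + y * B) ->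
    eval_vec z w (x * A + y * B) = c ->
    exists a b, F = x * A + y * B + l * a + m * b.
  move=> hAB cE; have : point_ideal z w (F - (x * A + y * B)).
    apply/(point_ideal_bihomog (generic_x0 gen) (generic_y0 gen)).
      exact: bihomogB hF hAB.
    rewrite /eval_vec mevalB; apply/eqP; rewrite subr_eq0; apply/eqP.
    exact: (esym cE).
  case/point_idealP => a [b FE]; exists a, b.
  by rewrite -[LHS](subrK (x * A + y * B)) FE; ring.
have evxy a b : eval_vec z w (c *: (x ^+ a * y ^+ b)) = c.
  by rewrite /eval_vec mevalZ mevalM !rmorphXn /= -!/(eval_vec z w _) x1 y1 !expr1n !mulr1.
case eE : e => [e1 e2]; case: e1 eE => [|e1] eE.
  case: e2 eE => [|e2] eE.
    have [||a [b FE]] := split_off 0 0.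
    - by rewrite !mulr0 addr0; apply: bihomog0.
    - rewrite !mulr0 addr0 /eval_vec meval0 /c.
      have := bihomog_eval_scale 0 0 z w hF; rewrite eE !expr0 !mul1r !scale0r => <-.
      by rewrite eval_vec0; move/irrelevantP: irr.
    by exists 0, 0, a, b; split=> //; left.
  have hB : bihomog (0, e2)%N (c *: (x ^+ 0 * y ^+ e2)).
    exact/bihomogZ/bihomog_xy_exp.
  have yBE : y * (c *: (x ^+ 0 * y ^+ e2)) = c *: (x ^+ 0 * y ^+ e2.+1).
    by rewrite -scalerAr mulrCA -exprS.
  have [||a [b FE]] := split_off 0 (c *: (x ^+ 0 * y ^+ e2)).
  - by rewrite mulr0 add0r yBE eE; apply/bihomogZ/bihomog_xy_exp.
  - by rewrite mulr0 add0r yBE evxy.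
  by exists 0, (c *: (x ^+ 0 * y ^+ e2)), a, b; split=> //; [left|right; exists (0, e2)%N].
have hA : bihomog (e1, e2)%N (c *: (x ^+ e1 * y ^+ e2)).
  exact/bihomogZ/bihomog_xy_exp.
have xAE : x * (c *: (x ^+ e1 * y ^+ e2)) = c *: (x ^+ e1.+1 * y ^+ e2).
  by rewrite -scalerAr mulrA -exprS.
have [||a [b FE]] := split_off (c *: (x ^+ e1 * y ^+ e2)) 0.
- by rewrite mulr0 addr0 xAE eE; apply/bihomogZ/bihomog_xy_exp.
- by rewrite mulr0 addr0 xAE evxy.
by exists (c *: (x ^+ e1 * y ^+ e2)), 0, a, b; split=> //; [right; exists (e1, e2)%N|left].
Qed.

(** By injectivity of [d2] such an expression would lift to F2, where the coordinate
    of index [j] would write 1 as an element of the irrelevant ideal. *)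
Lemma basis_not_irrelevant (j : 'I_n2) n (a : 'I_n -> R) (t : 'I_n -> 'rV[R]_n1) :
  (forall i, irrelevant (a i)) -> (forall i, d1 (t i) = 0) ->
  d2 (delta_mx 0 j) <> \sum_(i < n) a i *: t i.
Proof.
move=> irr ht eq_d2.
have [u hu] := fin_all_exists (fun i => syzygyP (ht i)).
have : delta_mx 0 j = \sum_(i < n) a i *: u i.
  apply: (res_exact2 hres); rewrite eq_d2 raddf_sum; apply: eq_bigr => i _.
  by rewrite /= linearZ_LR hu.
move/rowP/(_ j); rewrite mxE !eqxx summxE /= => one.
have : irrelevant (1 : R).
  have -> : 1 = \sum_(i < n) (a i *: u i) 0 j :> R by exact: one.
  apply: ideal_sum; first exact: ideal_gen_ideal.
  move=> i _; rewrite mxE; apply: ideal_mulr; [exact: ideal_gen_ideal|exact: irr].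
by move/irrelevantP/eqP; rewrite mcoeff1 eqxx oner_eq0.
Qed.

(** Let s be the image of a basis vector of degree d + (1, 1). By minimality its
    entries are irrelevant, so s = x vA + y vB + l va + m vb. The forms d1 vA and
    d1 vB have degrees d + (0, 1) and d + (1, 0) and opposite values at Z, so for
    a suitable scalar c both d1 vA - c y G and d1 vB + c x G vanish at Z, and lie
    in (l, m) I. If G = d1 g, then adding - c y g to vA and c x g to vB does not
    change x vA + y vB; after this change vA and vB are syzygies up to (l, m) F1,
    and so are the remaining coefficients of [l] and [m] after a Koszul
    correction. *)
Lemma form_notin_second_shifts d G : bihomog d G -> I G -> eval_vec z w G != 0 ->
  d + (1, 1)%N \notin S2.
Proof.
move=> hG IG G0; apply/tnthP => -[j dj].
have [x [hx x1 _]] := exists_xdual (generic_x0 gen).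
have [y [hy y1 _]] := exists_ydual (generic_y0 gen).
set s := d2 (delta_mx 0 j).
have hs : free_homog S1 (d + (1, 1)%N) s.
  by rewrite dj; apply: (res_graded2 hres); apply: free_homog_delta.
have dec i : exists q : R * R * R * R,
    [/\ s 0 i = x * q.1.1.1 + y * q.1.1.2 + l * q.1.2 + m * q.2,
      q.1.1.1 = 0 \/ exists e, d + (0, 1)%N = tnth S1 i + e /\ bihomog e q.1.1.1 &
      q.1.1.2 = 0 \/ exists e, d + (1, 0)%N = tnth S1 i + e /\ bihomog e q.1.1.2].
  have [s0|[e [de he]]] := hs i.
    exists (0, 0, 0, 0); split=> /=; [|by left|by left].
    by rewrite s0 !mulr0 !addr0.
  have [A [B [a [b [sE hA hB]]]]] :=
    split_irrelevant hx hy x1 y1 he (res_minimal2 hres _ i).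
  exists (A, B, a, b); split=> //=.
    case: hA => [|[f [ef hf]]]; [by left|right; exists f; split=> //].
    exact: (shift_cancel (a := (1, 0)%N) (b := (0, 1)%N) de ef).
  case: hB => [|[f [ef hf]]]; [by left|right; exists f; split=> //].
  exact: (shift_cancel (a := (0, 1)%N) (b := (1, 0)%N) de ef).
have [q hq] := fin_all_exists dec.
pose vA := \row_i (q i).1.1.1; pose vB := \row_i (q i).1.1.2.
pose va := \row_i (q i).1.2; pose vb := \row_i (q i).2.
have sE : s = x *: vA + y *: vB + l *: va + m *: vb.
  by apply/rowP => i; rewrite !mxE; case: (hq i).
have hp : bihomog (d + (0, 1)%N) (d1 vA).
  by apply: (res_graded1 hres) => i; rewrite mxE; case: (hq i).
have hr : bihomog (d + (1, 0)%N) (d1 vB).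
  by apply: (res_graded1 hres) => i; rewrite mxE; case: (hq i).
have d1s : x * d1 vA + y * d1 vB + l * d1 va + m * d1 vb = 0.
  by rewrite -!d1Z -!d1D -sE d1d2.
pose c := eval_vec z w (d1 vA) / eval_vec z w G.
have evB : eval_vec z w (d1 vB) = - eval_vec z w (d1 vA).
  have := congr1 (eval_vec z w) d1s.
  rewrite /eval_vec !mevalD !mevalM meval0 -!/(eval_vec z w _) x1 y1 eval_xform eval_yform.
  by rewrite !det2uu !mul0r !addr0 !mul1r addrC => /eqP; rewrite addr_eq0 => /eqP.
have [g gE] := d1_I IG.
have [u1 [u2 pE]] : exists u v, d1 vA - c *: (y * G) = l * d1 u + m * d1 v.
  apply: point_ideal_I.
    apply: idealB => //; first exact: I_d1.
    by apply: idealZ => //; apply: ideal_mull.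
  apply/(point_ideal_bihomog (d := d + (0, 1)%N) (generic_x0 gen) (generic_y0 gen)).
    by apply: bihomogB => //; apply: bihomogZ; rewrite addrC; apply: bihomogM.
  rewrite /eval_vec mevalB mevalZ mevalM -!/(eval_vec z w _) y1 mul1r.
  by rewrite divfK // subrr.
have [u3 [u4 rE]] : exists u v, d1 vB + c *: (x * G) = l * d1 u + m * d1 v.
  apply: point_ideal_I.
    apply: idealD => //; first exact: I_d1.
    by apply: idealZ => //; apply: ideal_mull.
  apply/(point_ideal_bihomog (d := d + (1, 0)%N) (generic_x0 gen) (generic_y0 gen)).
    by apply: bihomogD => //; apply: bihomogZ; rewrite addrC; apply: bihomogM.
  rewrite /eval_vec mevalD mevalZ mevalM -!/(eval_vec z w _) x1 mul1r.
  by rewrite divfK // evB addNr.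
(* what is left over as coefficients of [l] and [m] *)
pose A := va + x *: u1 + y *: u3; pose B := vb + x *: u2 + y *: u4.
(* [A] and [B] are syzygies up to the Koszul relation m * l = l * m *)
have [|h [AE BE]] := @forms_regular (d1 A) (d1 B).
  rewrite /A /B !d1D !d1Z -[RHS]d1s.
  have -> : d1 vA = c *: (y * G) + (l * d1 u1 + m * d1 u2) :> R.
    by rewrite -pE addrC subrK.
  have -> : d1 vB = (l * d1 u3 + m * d1 u4) - c *: (x * G) :> R.
    by rewrite -rE addrK.
  by rewrite -!mul_mpolyC; ring.
have Ih : I h.
  apply: (nzd_xform gen); have := idealN hI (I_d1 B); rewrite BE.
  by congr I; ring.
have [r rhE] := d1_I Ih.
pose t : 'I_4 -> 'rV[R]_n1 := fun i => nth 0
  [:: vA - (c *: y) *: g - l *: u1 - m *: u2;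
      vB + (c *: x) *: g - l *: u3 - m *: u4;
      A - m *: r; B + l *: r] i.
pose a : 'I_4 -> R := fun i => nth 0 [:: x; y; l; m] i.
apply: (@basis_not_irrelevant j _ a t).
- case=> [[|[|[|[|//]]]] lti]; rewrite /a /=;
    [apply: irrelevant_bihomog hx|apply: irrelevant_bihomog hy
    |apply: irrelevant_bihomog (bihomog_xform z)
    |apply: irrelevant_bihomog (bihomog_yform w)] => //.
- case=> [[|[|[|[|//]]]] lti]; rewrite /t /=.
  + rewrite !d1B !d1Z gE -scalerAl.
    by rewrite pE; ring.
  + rewrite !d1B d1D !d1Z gE -scalerAl.
    by rewrite rE; ring.
  + by rewrite d1B d1Z AE rhE; ring.
  + by rewrite d1D d1Z BE rhE; ring.
- rewrite !big_ord_recl big_ord0 /a /t /= -/s sE /A /B.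
  apply/rowP => i; rewrite !mxE -!mul_mpolyC; ring.
Qed.

Section Converse.
Variables (P : P1P1 k) (d : nat * nat) (F : R).
Local Notation lP := (xform (cx P)).
Local Notation mP := (yform (cy P)).
Hypotheses (PX : P \in X) (sepF : separator X P F) (hF : bihomog d F).

(** [F] vanishes at the other points and [f] vanishes at [P]. *)
Lemma line_mul_separator e f : bihomog e f -> eval_at P f = 0 -> I (f * F).
Proof.
move=> hf fP; apply/(ideal_of_bihomog _ (bihomogM hf hF)) => Q QX.
rewrite eval_atM; have [->|QP] := eqVneq Q P; first by rewrite fP mul0r.
by case: sepF => _ _ ->; rewrite ?mulr0 // in_fsetD1 QP.
Qed.

Lemma homog_lift e G : bihomog e G -> I G -> exists2 v, free_homog S1 e v & d1 v = G.
Proof.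
move=> hG /d1_I [v vE]; exists (row_comp S1 e v); first exact: free_homog_row_comp.
rewrite -(graded_row_comp (g := @bicomp k e : {additive R^o -> R^o})) => [|E u hu].
  by rewrite /= vE (bicomp_bihomog e hG) eqxx.
rewrite -(eq_sym e) /=; exact: (bicomp_bihomog e (res_graded1 hres hu)).
Qed.

(** Two linear forms in the x's with different zeros span all of them, and likewise
    for the y's. *)
Lemma irrelevant_forms G : irrelevant G ->
  exists a b a' b', G = a * lP + b * l + a' * mP + b' * m.
Proof.
have xP : det2 (cx P) z != 0 by apply: (generic_x gen).
have yP : det2 (cy P) w != 0 by apply: (generic_y gen).
apply: (ideal_genP (J := fun G => exists a b a' b', G = a * lP + b * l + a' * mP + b' * m)).
  split.
  - by exists 0, 0, 0, 0; rewrite !mul0r !addr0.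
  - move=> A B [a [b [a' [b' ->]]]] [c [e [c' [e' ->]]]].
    by exists (a + c), (b + e), (a' + c'), (b' + e'); ring.
  - move=> A B [a [b [a' [b' ->]]]].
    by exists (A * a), (A * b), (A * a'), (A * b'); ring.
move=> H [j ->]; case: (split_ordP j) => i ->.
  rewrite (linform_span (@lshift 2 2) i xP) -!mul_mpolyC.
  by do 2 eexists; exists 0, 0; rewrite -mulNr !mul0r !addr0.
rewrite (linform_span (@rshift 2 2) i yP) -!mul_mpolyC.
by exists 0, 0; do 2 eexists; rewrite -mulNr !mul0r !add0r.
Qed.

(** The ideal (lP, l, m) is generated by both x's and [m]. It is the kernel of
    x_i := 0, y_i := w_i y, and [mP] is mapped to a nonzero multiple of [y]. *)
Lemma cancel_yform G A B C : G * mP = A * lP + B * l + C * m ->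
  exists a b c, G = a * lP + b * l + c * m.
Proof.
move=> GE; have [y [hy y1 hyw]] := exists_ydual (generic_y0 gen).
have xP : det2 (cx P) z != 0 by apply: (generic_x gen).
pose J H := exists a b c, H = a * lP + b * l + c * m.
have hJ : is_ideal J.
  split.
  - by exists 0, 0, 0; rewrite !mul0r !addr0.
  - move=> H H' [a [b [c ->]]] [a' [b' [c' ->]]].
    by exists (a + a'), (b + b'), (c + c'); ring.
  - by move=> H H' [a [b [c ->]]]; exists (H * a), (H * b), (H * c); ring.
have y0 : y != 0.
  by apply: contraTneq (oner_neq0 k) => y0; rewrite -(y1 0) y0 /eval_vec meval0 eqxx.
have : along 0 w 0 y (G * mP) = 0.
  rewrite GE !raddfD /= !rmorphM /= !along_xform !along_yform det2uu scale0r.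
  by rewrite !scaler0 !mulr0 !addr0.
rewrite rmorphM /= along_yform => /eqP; rewrite mulf_eq0 scaler_eq0 (negbTE y0) orbF.
rewrite (negbTE (generic_y gen PX)) orbF => /eqP G0.
rewrite -[G]subr0 -G0 -/(J _); apply: along_cong => // i.
  rewrite mxE scale0r subr0.
  rewrite (linform_span (@lshift 2 2) i xP) -!mul_mpolyC.
  by do 2 eexists; exists 0; rewrite -mulNr !mul0r !addr0.
have [c ->] := hyw i; exists 0, 0, c%:MP.
by rewrite !mul0r !add0r mul_mpolyC.
Qed.

(** If no shift equals D = d + (1, 1), then the syzygy s = mP p - lP q is an
    irrelevant combination lP s1 + l s2 + mP s3 + m s4 of syzygies. Then
    mP (p - s3) is in (lP, l, m) F1, hence so is p - s3; applying [d1] gives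
    lP F = lP G modulo (l, m) with G in [I], and [lP] can be cancelled. *)
Lemma separator_second_shift : ~ adjoin (adjoin I l) m F -> d + (1, 1)%N \in S2.
Proof.
move=> nF; apply/negPn/negP => dS2; apply: nF.
have lPF : I (lP * F).
  by apply: (line_mul_separator (bihomog_xform _)); rewrite /eval_at eval_xform det2uu.
have mPF : I (mP * F).
  by apply: (line_mul_separator (bihomog_yform _)); rewrite /eval_at eval_yform det2uu.
have [p hp pE] := homog_lift (bihomogM (bihomog_xform _) hF) lPF.
have [q hq qE] := homog_lift (bihomogM (bihomog_yform _) hF) mPF.
pose D := d + (1, 1)%N; pose s := mP *: p - lP *: q.
have hs : free_homog S1 D s.
  have step (f : R) (e e' : nat * nat) v : bihomog e f ->
      free_homog S1 (e' + d) v -> e + e' = (1, 1)%N -> free_homog S1 D (f *: v).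
    move=> hf hv ee i; rewrite mxE; case: (hv i) => [->|[g [gE hg]]].
      by left; rewrite mulr0.
    right; exists (e + g); split; last exact: bihomogM.
    by rewrite addrCA -gE addrA ee addrC.
  have h1 := step _ _ _ _ (bihomog_yform (cy P)) hp erefl.
  have h2 := step _ _ _ _ (bihomog_xform (cx P)) hq erefl.
  move=> i; rewrite !mxE; move: (h1 i) (h2 i); rewrite !mxE.
  move=> [->|[e [De he]]] [->|[e' [De' he']]].
  - by left; rewrite subr0.
  - by right; exists e'; split=> //; apply: bihomogB => //; apply: bihomog0.
  - by right; exists e; split=> //; apply: bihomogB => //; apply: bihomog0.
  right; exists e; split=> //; apply: bihomogB => //.
  suff -> : e = e' by [].
  move: De; rewrite De' -[tnth S1 i + e]addrC => /esym eE.
  move: eE; case: (tnth S1 i) e e' {De' he he'} => [a a'] [b b'] [c c'].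
  rewrite -!/((_ + _)%N, (_ + _)%N) => -[eq1 eq2]; congr pair.
    by move: eq1; rewrite /= -!/(addn _ _); lia.
  by move: eq2; rewrite /= -!/(addn _ _); lia.
have [u uE] : exists u, d2 u = s.
  by apply: syzygyP; rewrite d1B !d1Z pE qE; ring.
(* passing to components makes the preimage homogeneous *)
have {uE} uE : d2 (row_comp S2 D u) = s.
  rewrite -(graded_row_comp (g := row_comp S1 D)) => [|E v hv].
    by rewrite /= uE (row_comp_homog _ hs) eqxx.
  by rewrite /= (row_comp_homog _ (res_graded2 hres hv)).
set v := row_comp S2 D u in uE.
(* entry j has degree D minus the shift of index j, which is not (0, 0) *)
have irr j : irrelevant (v 0 j).
  case: (free_homog_row_comp S2 D u j) => [->|[e [De he]]].
    by apply/irrelevantP; rewrite mcoeff0.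
  apply: irrelevant_bihomog he => e0; move/negP: dS2; apply.
  by rewrite -/D De e0 addr0 mem_tnth.
have dec j : exists q : R * R * R * R,
    v 0 j = q.1.1.1 * lP + q.1.1.2 * l + q.1.2 * mP + q.2 * m.
  have [a [b [a' [b' vE]]]] := irrelevant_forms (irr j).
  by exists (a, b, a', b').
have [c cE] := fin_all_exists dec.
pose v1 := \row_j (c j).1.1.1; pose v2 := \row_j (c j).1.1.2.
pose v3 := \row_j (c j).1.2; pose v4 := \row_j (c j).2.
have vE : v = lP *: v1 + l *: v2 + mP *: v3 + m *: v4.
  by apply/rowP => j; rewrite cE !mxE; ring.
have key : mP *: (p - d2 v3) = lP *: (q + d2 v1) + l *: d2 v2 + m *: d2 v4.
  have : s = lP *: d2 v1 + l *: d2 v2 + mP *: d2 v3 + m *: d2 v4.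
    by rewrite -uE vE !linearD !linearZ_LR.
  by rewrite /s scalerBr scalerDr; apply: regroup_syzygies.
have dec' i : exists r : R * R * R,
    (p - d2 v3) 0 i = r.1.1 * lP + r.1.2 * l + r.2 * m.
  have [|a [b [c' aE]]] := @cancel_yform ((p - d2 v3) 0 i)
      ((q + d2 v1) 0 i) (d2 v2 0 i) (d2 v4 0 i).
    have /rowP/(_ i) := key; rewrite mulrC.
    by rewrite !mxE => ->; rewrite ![_ * lP]mulrC ![_ * l]mulrC ![_ * m]mulrC.
  by exists (a, b, c').
have [r rE] := fin_all_exists dec'.
pose g := \row_i (r i).1.1; pose a := \row_i (r i).1.2; pose b := \row_i (r i).2.
have pvE : p - d2 v3 = lP *: g + l *: a + m *: b.
  by apply/rowP => i; rewrite rE !mxE; ring.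
have lPE : lP * F = lP * d1 g + l * d1 a + m * d1 b.
  by rewrite -!d1Z -!d1D -pvE d1B d1d2 subr0.
have : point_ideal z w (F - d1 g).
  apply/(point_ideal_restrict _ (generic_x0 gen) (generic_y0 gen)).
  have : restrict z w (lP * (F - d1 g)) = 0.
    apply/(point_ideal_restrict _ (generic_x0 gen) (generic_y0 gen))/point_idealP.
    by exists (d1 a), (d1 b); rewrite mulrBr lPE; ring.
  rewrite /restrict rmorphM /= along_xform => /eqP.
  rewrite mulf_eq0 scaler_eq0 (negbTE (generic_x gen PX)) (negbTE (var_neq0 _ _)).
  by move/eqP.
case/point_idealP => a' [b' FE]; exists b', a'.
have -> : F - b' * m - a' * l = d1 g.
  by have -> : F = d1 g + (a' * l + b' * m); [rewrite -FE addrC subrK|ring].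
exact: I_d1.
Qed.

End Converse.

End Resolution.

Theorem theorem4p6 (k : closedFieldType) (hk : [pchar k] =i pred0)
    (X : {fset P1P1 k}) (hX : ACM X)
    (n1 n2 : nat) (S1 : n1.-tuple (nat * nat)) (S2 : n2.-tuple (nat * nat))
    (d1 : {linear 'rV[biring k]_n1 -> (biring k)^o})
    (d2 : {linear 'rV[biring k]_n2 -> 'rV[biring k]_n1})
    (hres : minimal_resolution (ideal_of X) S1 S2 d1 d2)
    (P : P1P1 k) (hP : P \in X) (d : nat * nat) (hd : in_deg X P d) :
  ACM (X `\ P)%fset <-> d + (1%N, 1%N) \in S2.
Proof.
have [F sepF hF] := proj1 hd; have F0 : F != 0.
  case: sepF => _ + _; apply: contraNneq => ->; rewrite /eval_at /eval_vec meval0 //.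
have [z [w [gen Fzw]]] := exists_generic X F0.
have regX := ACM_nzd gen hX.
have removeP := ACM_remove_iff hP gen hd sepF hF regX.
split=> [/removeP|dS2]; first exact: (separator_second_shift hres gen hP sepF hF).
apply/removeP => -[b [a FI]].
(* The component of degree d of F - H lies in I, and at Z it has the value of F
   since H vanishes on the plane over Z. *)
pose H := b * yform w + a * xform z.
have {}FI : ideal_of X (bicomp d (F - H)).
  by apply: ideal_of_bicomp; move: FI; congr ideal_of; rewrite /H; ring.
suff FHzw : eval_vec z w (bicomp d (F - H)) != 0.
  by case/negP: (form_notin_second_shifts hres gen regX (bihomog_bicomp d _) FI FHzw).
rewrite raddfB /= (bicomp_bihomog _ hF) eqxx /eval_vec mevalB.
have : restrict z w H = 0.
  rewrite /restrict raddfD /= !rmorphM /= along_xform along_yform.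
  by rewrite !det2uu !scale0r !mulr0 addr0.
by move=> /restrict_eq0/(_ d); rewrite /eval_vec => ->; rewrite subr0.
Qed.
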